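(* Let $n\ge 3$ and $2\le k\le n$, and let $(M^n,g,X,\lambda)$ be a compact $k$-Yamabe soliton, i.e. $(M^n,g)$ is a compact Riemannian manifold of dimension $n$, $X$ is a smooth vector field on $M$ and $\lambda\in\mathbb{R}$ is a constant such that $\frac12\mathcal{L}_Xg=2(n-1)(\sigma_k-\lambda)g$. If $(M^n,g)$ has nonpositive Ricci curvature, then the soliton $(M^n,g,X,\lambda)$ is trivial.
   Context: Compact manifolds are without boundary. For a Riemannian manifold $(M^n,g)$ with Ricci tensor $Ric_g$ and scalar curvature $scal_g$, the Schouten tensor is $A_g=\frac{1}{n-2}\left(Ric_g-\frac{scal_g}{2(n-1)}g\right)$. For $1\le k\le n$, the $\sigma_k$-curvature of $g$ is the $k$-th elementary symmetric function of the eigenvalues $\lambda_1,\dots,\lambda_n$ of the symmetric endomorphism $g^{-1}A_g$: $\sigma_k=\sum_{i_1<\dots<i_k}\lambda_{i_1}\cdots\lambda_{i_k}$, a function on $M$. $\mathcal{L}_Xg$ is the Lie derivative of $g$ along $X$. Nonpositive Ricci curvature means $Ric_g(v,v)\le 0$ for every tangent vector $v$. The soliton $(M^n,g,X,\lambda)$ is called trivial when $X$ is a Killing vector field ($\mathcal{L}_Xg=0$); in this case $\sigma_k=\lambda$ on $M$. *)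

(* Defs.v *)
From HB Require Import structures.
From mathcomp Require Import all_boot all_order all_algebra.
From mathcomp Require Import all_classical all_reals all_analysis.

Set Implicit Arguments.
Unset Strict Implicit.
Unset Printing Implicit Defensive.

Import Order.TTheory GRing.Theory Num.Theory.
Import numFieldNormedType.Exports.

Local Open Scope classical_set_scope.
Local Open Scope ring_scope.

Section Calculus.
Variables (R : realType) (n : nat).

Definition partial (W : normedModType R) (a : 'I_n) (f : 'rV[R]_n -> W)
  : 'rV[R]_n -> W := fun x => 'D_(delta_mx 0 a) f x.

Definition partials (W : normedModType R) (s : seq 'I_n) (f : 'rV[R]_n -> W)
  : 'rV[R]_n -> W := foldr (@partial W) f s.

(* For open D this is C^infinity on D: all iterated partial derivatives exist
   and are continuous.  The values of f outside D are irrelevant. *)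
Definition smooth_on (W : normedModType R) (D : set 'rV[R]_n)
    (f : 'rV[R]_n -> W) : Prop :=
  forall (s : seq 'I_n) (x : 'rV[R]_n), D x ->
    {for x, continuous (partials s f)} /\
    forall a : 'I_n, derivable (partials s f) x (delta_mx 0 a).

End Calculus.

(* Geometry of a metric G = (G_ab) on an open subset of R^n, in the standard
   coordinates; d_a = partial a. *)
Section LocalGeometry.
Variables (R : realType) (n : nat).
Implicit Types (G T : 'rV[R]_n -> 'M[R]_n) (X : 'rV[R]_n -> 'rV[R]_n).
Implicit Types (x : 'rV[R]_n) (a b c d e : 'I_n).

(* Gamma^c_ab *)
Definition christoffel G c a b x : R :=
  2^-1 * \sum_d invmx (G x) c d *
    (partial a (fun y => G y d b) x + partial b (fun y => G y d a) x
     - partial d (fun y => G y a b) x).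

(* The component Riem^d_cab given by Riem(d_a, d_b) d_c = Riem^d_cab d_d, where
   Riem(Y, Z) = [nabla_Y, nabla_Z] - nabla_[Y, Z]. *)
Definition riemann G d c a b x : R :=
  partial a (christoffel G d b c) x - partial b (christoffel G d a c) x
  + \sum_e (christoffel G d a e x * christoffel G e b c x
            - christoffel G d b e x * christoffel G e a c x).

(* Ric(Y, Z) is the trace of V |-> Riem(V, Y) Z (positive on round spheres). *)
Definition ricci G x : 'M[R]_n :=
  \matrix_(b, c) \sum_a riemann G a c a b x.

Definition scal G x : R := \tr (invmx (G x) *m ricci G x).

Definition schouten G x : 'M[R]_n :=
  (n%:R - 2)^-1 *: (ricci G x - (scal G x / (2 * (n%:R - 1))) *: G x).

(* The eigenvalues of B with multiplicity, in an unspecified order; 0 by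
   convention if char_poly B does not split over R, which does not happen for
   B self-adjoint with respect to an inner product. *)
Definition eigenvalues (B : 'M[R]_n) : 'rV[R]_n :=
  xget 0 [set l : 'rV[R]_n | char_poly B = \prod_i ('X - (l 0 i)%:P)].

Definition elementary_symmetric (k : nat) (l : 'rV[R]_n) : R :=
  \sum_(I : {set 'I_n} | #|I| == k) \prod_(i in I) l 0 i.

Definition sigma (k : nat) G x : R :=
  elementary_symmetric k (eigenvalues (invmx (G x) *m schouten G x)).

(* (L_X T)_ab = X^c d_c T_ab + T_cb d_a X^c + T_ac d_b X^c *)
Definition lie_derivative X T x : 'M[R]_n :=
  \matrix_(a, b) \sum_c
    (X x 0 c * partial c (fun y => T y a b) x
     + T x c b * partial a (fun y => X y 0 c) x
     + T x a c * partial b (fun y => X y 0 c) x).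

End LocalGeometry.

(* cinv is only meaningful on cmap @` cdom, and cmap only on cdom. *)
Record chart (R : realType) (n : nat) (M : topologicalType) := Chart {
  cdom : set M;
  cmap : M -> 'rV[R]_n;
  cinv : 'rV[R]_n -> M;
  cdom_open : open cdom;
  cimg_open : open (cmap @` cdom);
  cmap_continuous : {within cdom, continuous cmap};
  cinv_continuous : {within cmap @` cdom, continuous cinv};
  cmapK : {in cdom, cancel cmap cinv}
}.

Section Transition.
Variables (R : realType) (n : nat) (M : topologicalType).
Implicit Types phi psi : chart R n M.

Definition cimg phi : set 'rV[R]_n := cmap phi @` cdom phi.

Definition overlap phi psi : set 'rV[R]_n :=
  cmap phi @` (cdom phi `&` cdom psi).

Definition transition phi psi : 'rV[R]_n -> 'rV[R]_n := cmap psi \o cinv phi.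

End Transition.

(* A smooth structure (without boundary) of dimension n on M. *)
Record smooth_manifold (R : realType) (n : nat) (M : topologicalType) :=
  SmoothManifold {
    manifold_hausdorff : hausdorff_space M;
    manifold_second_countable : @second_countable M;
    cindex : Type;
    atlas :> cindex -> chart R n M;
    atlas_cover : forall p : M, exists i, cdom (atlas i) p;
    atlas_smooth : forall i j, smooth_on (overlap (atlas i) (atlas j))
                                 (transition (atlas i) (atlas j))
  }.

(* Tensor fields are given by their components in the charts of the atlas.
   Tangent vectors are row vectors, pushed forward by v |-> v *m 'J. *)
Record riemannian_metric (R : realType) (n : nat) (M : topologicalType)
    (S : smooth_manifold R n M) := RiemannianMetric {
  metric :> cindex S -> 'rV[R]_n -> 'M[R]_n;
  metric_smooth : forall i, smooth_on (cimg (S i)) (metric i);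
  metric_sym : forall i x, cimg (S i) x -> (metric i x)^T = metric i x;
  metric_pos : forall i x, cimg (S i) x ->
    forall v : 'rV[R]_n, v != 0 -> 0 < (v *m metric i x *m v^T) 0 0;
  metric_compat : forall i j x, overlap (S i) (S j) x ->
    let J := jacobian (transition (S i) (S j)) x in
    metric i x = J *m metric j (transition (S i) (S j) x) *m J^T
}.

Record vector_field (R : realType) (n : nat) (M : topologicalType)
    (S : smooth_manifold R n M) := VectorField {
  vfield :> cindex S -> 'rV[R]_n -> 'rV[R]_n;
  vfield_smooth : forall i, smooth_on (cimg (S i)) (vfield i);
  vfield_compat : forall i j x, overlap (S i) (S j) x ->
    vfield j (transition (S i) (S j) x)
      = vfield i x *m jacobian (transition (S i) (S j)) x
}.

Section Solitons.
Variables (R : realType) (n : nat) (M : topologicalType).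
Variables (S : smooth_manifold R n M) (g : riemannian_metric S).

Definition nonpositive_ricci : Prop :=
  forall i x, cimg (S i) x ->
    forall v : 'rV[R]_n, (v *m ricci (g i) x *m v^T) 0 0 <= 0.

Definition k_yamabe_soliton (k : nat) (X : vector_field S) (lambda : R)
    : Prop :=
  forall i x, cimg (S i) x ->
    2^-1 *: lie_derivative (X i) (g i) x
      = (2 * (n%:R - 1) * (sigma k (g i) x - lambda)) *: g i x.

Definition killing (X : vector_field S) : Prop :=
  forall i x, cimg (S i) x -> lie_derivative (X i) (g i) x = 0.

Definition trivial_soliton (X : vector_field S) : Prop := killing X.

End Solitons.

(* Main.v *)
Require Import Defs.
From mathcomp Require Import all_boot all_order all_algebra.
From mathcomp Require Import all_classical all_reals all_analysis.
From mathcomp Require Import ring lra.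

Set Implicit Arguments.
Unset Strict Implicit.
Unset Printing Implicit Defensive.

Import Order.TTheory GRing.Theory Num.Theory.
Import numFieldNormedType.Exports.

Local Open Scope classical_set_scope.
Local Open Scope ring_scope.


(** The soliton equation says in particular that X is a conformal field,
L_X g = mu g for a function mu, and a conformal field on a compact manifold
with nonpositive Ricci curvature is Killing.  This is usually proved by
integrating a Bochner formula; the proof below replaces the integration by the
strong maximum principle, so that everything stays local.

Write T_ab = nabla_a X_b and u = |X|^2.  The conformal equation reads
T_ab + T_ba = mu g_ab.  Differentiating it, commuting derivatives by the Ricci
identity and tracing gives
  g^ca nabla_c T_ab = - (n - 2)/2 d_b mu - Ric_be X^e,
hence the Bochner formula
  g^ab nabla_a nabla_b u = 2 |nabla X|^2 - 2 Ric(X, X) - (n - 2) X(mu).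
The term X(mu) has no sign.  But contracting the conformal equation with X
twice gives X(u) = mu u, so that, wherever u > 0, X(mu) is expressed by
second derivatives of u along X and by first order terms in u:
  u X(mu) = X^a X^b d_a d_b u + (first order terms in u).
Multiplying the Bochner formula by u and moving this term to the left yields
  (u g^ab + (n - 2) X^a X^b) d_a d_b u + (first order terms)
    = 2 u (|nabla X|^2 - Ric(X, X)) >= 0           (lemma bochner).
The operator on the left is elliptic where u > 0, since n >= 2.

On a connected component of M, which is compact, u has a maximum.  By Hopf's
strong maximum principle (strong_maximum_principle) the set where the maximum
is attained is open, hence u is constant on the component
(component_constant).  If this constant is 0, then X = 0 on the component;
otherwise X(u) = mu u forces mu = 0.  In both cases L_X g = 0
(killing_of_usq_constant). *)

(** * Scalar functions with continuous partial derivatives *)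

Lemma eq_continuous_at (T U : topologicalType) (D : set T) (f g : T -> U) x :
  open D -> (forall y, D y -> f y = g y) ->
  D x -> {for x, continuous f} -> {for x, continuous g}.
Proof.
move=> oD fg Dx fc; rewrite /prop_for /continuous_at -(fg _ Dx).
apply: cvg_trans fc; apply: near_eq_cvg.
have nD : nbhs x D by exact: open_nbhs_nbhs.
by apply: (filterS _ nD) => y Dy; rewrite /= fg.
Qed.

Section ScalarPartial.
Variables (R : realType) (n : nat).
Local Notation V := 'rV[R]_n.
Implicit Types (f g : V -> R) (x : V) (a b : 'I_n) (D : set V).

Definition pder f x a : Prop := derivable f x (delta_mx 0 a).

Lemma partialD f g x a : pder f x a -> pder g x a ->
  partial a (fun y => f y + g y) x = partial a f x + partial a g x.
Proof. by move=> df dg; exact: (deriveD df dg). Qed.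

Lemma partialB f g x a : pder f x a -> pder g x a ->
  partial a (fun y => f y - g y) x = partial a f x - partial a g x.
Proof. by move=> df dg; exact: (deriveB df dg). Qed.

Lemma partialM f g x a : pder f x a -> pder g x a ->
  partial a (fun y => f y * g y) x = f x * partial a g x + partial a f x * g x.
Proof.
by move=> df dg; rewrite [partial a f x * _]mulrC; exact: (deriveM df dg).
Qed.

Lemma partial_cst c x a : partial a (fun=> c : R) x = 0.
Proof. exact: derive_cst. Qed.

Lemma partial_sum I (r : seq I) (P : pred I) (F : I -> V -> R) x a :
  (forall i, P i -> pder (F i) x a) ->
  pder (fun y => \sum_(i <- r | P i) F i y) x a /\
  partial a (fun y => \sum_(i <- r | P i) F i y) x
    = \sum_(i <- r | P i) partial a (F i) x.
Proof.
move=> dF; elim: r => [|i r [IH1 IH2]].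
  have -> : (fun y => \sum_(i <- [::] | P i) F i y) = cst 0.
    by apply/funext => y; rewrite big_nil.
  by rewrite big_nil; split; [exact: derivable_cst|exact: partial_cst].
rewrite big_cons; case: (boolP (P i)) => Pi; last first.
  have -> : (fun y => \sum_(j <- i :: r | P j) F j y) =
     (fun y => \sum_(j <- r | P j) F j y) => //.
  by apply/funext => y; rewrite big_cons (negPf Pi).
have -> : (fun y => \sum_(j <- i :: r | P j) F j y) =
   (fun y => F i y + \sum_(j <- r | P j) F j y).
  by apply/funext => y; rewrite big_cons Pi.
have dFi := dF _ Pi; split; first exact: (derivableD dFi IH1).
by rewrite (partialD dFi IH1) IH2.
Qed.

Lemma eq_partial D f g x a : open D -> (forall y, D y -> f y = g y) -> D x ->
  partial a f x = partial a g x.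
Proof.
move=> oD fg Dx; apply: near_eq_derive.
by apply: (filterS fg); exact: open_nbhs_nbhs.
Qed.

Lemma eq_pder D f g x a : open D -> (forall y, D y -> f y = g y) -> D x ->
  pder f x a -> pder g x a.
Proof.
move=> oD fg Dx; apply: near_eq_derivable.
by apply: (filterS fg); exact: open_nbhs_nbhs.
Qed.

End ScalarPartial.

Section Ck.
Variables (R : realType) (n : nat).
Local Notation V := 'rV[R]_n.
Implicit Types (f g : V -> R) (x : V) (a b : 'I_n) (D : set V).

(** Class C^k on an open set.  The recursion on k makes the closure of the
class under sums, products and inverses a short induction. *)
Fixpoint ck (k : nat) (D : set V) f : Prop :=
  (forall x, D x -> {for x, continuous f}) /\
  if k is j.+1 then
    forall a, (forall x, D x -> pder f x a) /\ ck j D (partial a f)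
  else True.

Lemma ck_continuous k D f x : ck k D f -> D x -> {for x, continuous f}.
Proof. by case: k => [|k] [h _] /h. Qed.

Lemma ck_pder k D f x a : ck k.+1 D f -> D x -> pder f x a.
Proof. by case=> _ /(_ a)[h _] /h. Qed.

Lemma ck_partial k D f a : ck k.+1 D f -> ck k D (partial a f).
Proof. by case=> _ /(_ a)[_]. Qed.

Arguments ck_pder {k D f x} a _ _.
Arguments ck_partial {k D f} a _.

Lemma ckW k D f : ck k.+1 D f -> ck k D f.
Proof.
elim: k f => [|k IH] f [fc fa]; split => // a.
by have [? ?] := fa a; split => //; exact: IH.
Qed.

Lemma ck_sub k D D' f : D' `<=` D -> ck k D f -> ck k D' f.
Proof.
move=> sD; elim: k f => [|k IH] f [fc fa]; split => //.
- by move=> x /sD/fc.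
- by move=> x /sD/fc.
- by move=> a; have [h /IH ?] := fa a; split => // x /sD/h.
Qed.

Lemma ck_eq k D f g : open D -> (forall x, D x -> f x = g x) ->
  ck k D f -> ck k D g.
Proof.
move=> oD; elim: k f g => [|k IH] f g fg [fc fa].
  by split => // x Dx; exact: eq_continuous_at oD fg Dx (fc _ Dx).
split; first by move=> x Dx; exact: eq_continuous_at oD fg Dx (fc _ Dx).
move=> a; have [h hk] := fa a; split.
  by move=> x Dx; apply: eq_pder oD fg Dx (h _ Dx).
by apply: IH hk => x Dx; exact: eq_partial oD fg Dx.
Qed.

Lemma ck_cst k D (c : R) : ck k D (fun=> c).
Proof.
elim: k c => [|k IH] c; split => //; try by move=> x _; exact: cst_continuous.
move=> a; split; first by move=> x _; exact: derivable_cst.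
have -> : partial a (fun=> c) = (fun=> 0) :> (V -> R); last exact: IH.
by apply/funext => x; exact: partial_cst.
Qed.

Lemma ckD k D f g : open D -> ck k D f -> ck k D g ->
  ck k D (fun x => f x + g x).
Proof.
move=> oD; elim: k f g => [|k IH] f g [fc fa] [gc ga]; split => //.
- by move=> x Dx; exact: (continuousD (fc _ Dx) (gc _ Dx)).
- by move=> x Dx; exact: (continuousD (fc _ Dx) (gc _ Dx)).
move=> a; have [hf kf] := fa a; have [hg kg] := ga a; split.
  by move=> x Dx; exact: (derivableD (hf _ Dx) (hg _ Dx)).
apply: ck_eq (IH _ _ kf kg) => // x Dx.
exact/esym/(partialD (hf _ Dx) (hg _ Dx)).
Qed.

Lemma ckM k D f g : open D -> ck k D f -> ck k D g ->
  ck k D (fun x => f x * g x).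
Proof.
move=> oD; elim: k f g => [|k IH] f g hf hg.
  split => // x Dx; 
  exact: (continuousM (ck_continuous hf Dx) (ck_continuous hg Dx)).
split.
  move=> x Dx; 
  exact: (continuousM (ck_continuous hf Dx) (ck_continuous hg Dx)).
move=> a; split.
  by move=> x Dx; 
  exact: (derivableM (ck_pder a hf Dx) (ck_pder a hg Dx)).
have h1 := IH _ _ (ckW hf) (ck_partial a hg).
have h2 := IH _ _ (ck_partial a hf) (ckW hg).
apply: ck_eq (ckD oD h1 h2) => // x Dx.
exact/esym/(partialM (ck_pder a hf Dx) (ck_pder a hg Dx)).
Qed.

Lemma ckN k D f : open D -> ck k D f -> ck k D (fun x => - f x).
Proof.
move=> oD hf; apply: ck_eq (ckM oD (@ck_cst k D (-1)) hf) => // x _.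
by rewrite mulN1r.
Qed.

Lemma ckB k D f g : open D -> ck k D f -> ck k D g ->
  ck k D (fun x => f x - g x).
Proof. by move=> oD hf hg; apply: ckD => //; exact: ckN. Qed.

Lemma ck_sum k D I (r : seq I) (P : pred I) (F : I -> V -> R) : open D ->
  (forall i, P i -> ck k D (F i)) -> ck k D (fun x => \sum_(i <- r | P i) F i x).
Proof.
move=> oD hF; elim: r => [|i r IH].
  by apply: ck_eq (@ck_cst k D 0) => // x _; rewrite big_nil.
case: (boolP (P i)) => Pi; last first.
  by apply: ck_eq IH => // x _; rewrite big_cons (negPf Pi).
by apply: ck_eq (ckD oD (hF _ Pi) IH) => // x _; rewrite big_cons Pi.
Qed.

Lemma ck_prod k D I (r : seq I) (P : pred I) (F : I -> V -> R) : open D ->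
  (forall i, P i -> ck k D (F i)) ->
  ck k D (fun x => \prod_(i <- r | P i) F i x).
Proof.
move=> oD hF; elim: r => [|i r IH].
  by apply: ck_eq (@ck_cst k D 1) => // x _; rewrite big_nil.
case: (boolP (P i)) => Pi; last first.
  by apply: ck_eq IH => // x _; rewrite big_cons (negPf Pi).
by apply: ck_eq (ckM oD (hF _ Pi) IH) => // x _; rewrite big_cons Pi.
Qed.

Lemma ckV k D f : open D -> (forall x, D x -> f x != 0) -> ck k D f ->
  ck k D (fun x => (f x)^-1).
Proof.
move=> oD f0; elim: k => [|k IH] hf.
  by split => // x Dx; exact: (continuousV (f0 _ Dx) (ck_continuous hf Dx)).
split.
  by move=> x Dx; exact: (continuousV (f0 _ Dx) (ck_continuous hf Dx)).
move=> a; split.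
  by move=> x Dx; exact: (derivableV (f0 _ Dx) (ck_pder a hf Dx)).
have h := IH (ckW hf).
have := ckM oD (ckN oD (ckM oD h h)) (ck_partial a hf).
apply: ck_eq => // x Dx; 

apply/esym; apply: etrans (deriveV (f0 _ Dx) (ck_pder a hf Dx)) _.
by rewrite /GRing.scale /= -exprVn expr2.
Qed.

Lemma ck_coord k D a : open D -> ck k D (fun x => x 0 a).
Proof.
move=> oD.
have dc x b : is_derive x (delta_mx 0 b : V) (fun y : V => y 0 a : R)
    ((b == a)%:R).
  have dd : derivable (fun y : V => y) x (delta_mx 0 b) by exact: derivable_id.
  split; first by have /derivable_mxP := dd; apply.
  have := derive_mx dd; rewrite derive_id => /matrixP/(_ 0 a).
  by rewrite !mxE eqxx /= eq_sym => ->.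
case: k => [|k]; first by split => // x _; exact: coord_continuous.
split; first by move=> x _; exact: coord_continuous.
move=> b; split; first by move=> x _; have [] := dc x b.
apply: ck_eq (@ck_cst k D ((b == a)%:R)) => // x Dx.
by rewrite /partial; have [_ ->] := dc x b.
Qed.

End Ck.
Arguments ck_pder {R n k D f x} a _ _.
Arguments ck_partial {R n k D f} a _.

Section SmoothEntries.
Variables (R : realType) (n p q : nat).
Local Notation V := 'rV[R]_n.

(** The partial derivatives of a matrix-valued map are taken in the normed
space of matrices; entrywise they are those of the scalar entries. *)
Lemma partials_entry (D : set V) (F : V -> 'M[R]_(p, q)) (s : seq 'I_n) i j x :
  open D -> smooth_on D F -> D x ->
  partials s F x i j = partials s (fun y => F y i j) x.
Proof.
move=> oD sF; elim: s x => //= a s IH x Dx.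
have [_ dF] := sF s x Dx.
rewrite [LHS](_ : _ = partial a (fun y => partials s F y i j) x).
  by apply: eq_partial oD _ Dx => y Dy; exact: IH.
by rewrite /partial derive_mx// mxE.
Qed.

Lemma smooth_on_entry (D : set V) (F : V -> 'M[R]_(p, q)) i j k :
  open D -> smooth_on D F -> ck k D (fun x => F x i j).
Proof.
move=> oD sF.
suff H s : ck k D (partials s (fun x => F x i j)) by exact: (H [::]).
have cE t x : D x -> {for x, continuous (fun y => partials t F y i j)}.
  move=> Dx; have [cF _] := sF t x Dx.
  exact: (continuous_comp cF (@coord_continuous _ _ _ i j _)).
have pE t (x : V) a : D x -> pder (fun y => partials t F y i j) x a.
  by move=> Dx; have [_ /(_ a)/derivable_mxP] := sF t x Dx; apply.
elim: k s => [|k IH] s.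
  apply: (ck_eq oD (fun x => @partials_entry D F s i j x oD sF)).
  by split => // x; exact: cE.
apply: (ck_eq oD (fun x => @partials_entry D F s i j x oD sF)).
split => [x|a]; first exact: cE.
split; first by move=> x; exact: pE.
apply: ck_eq (IH (a :: s)) => // x Dx /=.
by apply/esym/(eq_partial _ oD) => // y Dy; exact: (@partials_entry D).
Qed.

End SmoothEntries.

(** * First and second order calculus *)

Section NormedEps.
Variables (R : realType) (V : normedModType R).

Lemma open_ball_norm (D : set V) x : open D -> D x ->
  exists2 r : R, 0 < r & forall y, `|y - x| < r -> D y.
Proof.
move=> oD Dx; have : nbhs x D by exact: open_nbhs_nbhs.
move=> /nbhs_ballP[r /= r0 sD]; exists r => // y xy; apply: sD.
by rewrite -ball_normE /= distrC.
Qed.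

Lemma continuous_eps (f : V -> R) x e : {for x, continuous f} -> 0 < e ->
  exists2 d : R, 0 < d & forall y, `|y - x| < d -> `|f y - f x| < e.
Proof.
move=> /cvgrPdist_lt/(_ e) + e0 => /(_ e0) /nbhs_ballP[d /= d0 H].
exists d => // y xy; rewrite distrC; apply: H.
by rewrite -ball_normE /= distrC.
Qed.

(** The difference quotients on both sides are the same function. *)
Lemma line_is_derive (f : V -> R) x v t : derivable f (x + t *: v) v ->
  is_derive (t : R) 1 (fun s : R => f (x + s *: v)) ('D_v f (x + t *: v)).
Proof.
have E : (fun h : R => h^-1 *:
     (((fun s => f (x + s *: v)) \o shift t) (h *: 1) - f (x + t *: v)))
   = (fun h => h^-1 *: ((f \o shift (x + t *: v)) (h *: v) - f (x + t *: v))).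
  apply/funext => h /=; congr (_ *: (f _ - _)).
  by rewrite [h%:A]mulr1 scalerDl addrCA.
move=> df; split; first by rewrite /derivable E.
by rewrite /derive E.
Qed.

End NormedEps.

Section Line.
Variable (R : realType).

(** The mean value theorem with no sign condition on the increment, so that it
applies to an arbitrary coordinate of a vector. *)
Lemma mvt_unsigned (phi dphi : R -> R) (b : R) :
  (forall t : R, `|t| <= `|b| -> is_derive t 1 phi (dphi t)) ->
  exists2 c, `|c| <= `|b| & phi b - phi 0 = dphi c * b.
Proof.
move=> dp.
have cont t : `|t| <= `|b| -> {for t, continuous phi}.
  move=> tb; apply: differentiable_continuous; apply/derivable1_diffP.
  by have [] := dp t tb.
have contw (a c : R) : (forall t, a <= t <= c -> `|t| <= `|b|) ->
    {within `[a, c], continuous phi}.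
  move=> H; apply: continuous_in_subspaceT => t.
  by rewrite inE /= in_itv /= => /H; exact: cont.
have [b0|b0|->] := ltgtP b 0; last first.
- by exists 0 => //; rewrite mulr0 subrr.
- have H t : 0 <= t <= b -> `|t| <= `|b|.
    by move=> /andP[t0 tb]; rewrite !ger0_norm// ltW.
  have dpi t : t \in `]0, b[%R -> is_derive t 1 phi (dphi t).
    by rewrite in_itv /= => /andP[t0 tb]; apply/dp/H; rewrite !ltW.
  have [c cb ->] := MVT b0 dpi (contw _ _ H).
  exists c; last by rewrite subr0.
  by apply: H; move: cb; rewrite in_itv /= => /andP[/ltW -> /ltW ->].
- have H t : b <= t <= 0 -> `|t| <= `|b|.
    by move=> /andP[tb t0]; rewrite !ler0_norm ?lerN2// ltW.
  have dpi t : t \in `]b, 0[%R -> is_derive t 1 phi (dphi t).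
    by rewrite in_itv /= => /andP[t0 tb]; apply/dp/H; rewrite !ltW.
  have [c cb E] := MVT b0 dpi (contw _ _ H).
  exists c.
    by apply: H; move: cb; rewrite in_itv /= => /andP[/ltW -> /ltW ->].
  by rewrite -[LHS]opprB E sub0r mulrN opprK.
Qed.

(** If the second derivative S at a maximum were positive, the first derivative
would be positive just after 0, and the function would increase there. *)
Lemma second_derivative_max (phi dphi : R -> R) (r S : R) : 0 < r ->
  (forall t : R, `|t| < r -> is_derive t 1 phi (dphi t)) ->
  is_derive (0 : R) 1 dphi S ->
  (forall t, `|t| < r -> phi t <= phi 0) ->
  dphi 0 = 0 /\ S <= 0.
Proof.
move=> r0 dp dS hmax.
have inr t : t \in `]-r, r[%R -> `|t| < r by rewrite in_itv /= ltr_norml.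
have d0 : dphi 0 = 0.
  have rr : - r <= r by rewrite (@le_trans _ _ 0)// ?oppr_le0 ltW.
  have r0i : (0 : R) \in `]-r, r[%R by rewrite in_itv /= oppr_lt0 r0.
  have [_ dm] : is_derive (0 : R) 1 phi 0.
    by apply: derive1_at_max rr _ r0i _ => t /inr; [move=> /dp[]|exact: hmax].
  have n0 : `|0 : R| < r by rewrite normr0.
  by have [_ <-] := dp 0 n0.
split => //; rewrite leNgt; apply/negP => S0.
have [dd1 dd2] := dS.
have : (fun h : R => h^-1 *: ((dphi \o shift 0) (h *: 1) - dphi 0)) @ 0^' --> S.
  by rewrite -dd2; exact: dd1.
move=> /cvgrPdist_lt/(_ S S0); rewrite near_withinE => /nbhs_ballP[d /= dp0 Hd].
have pos t : 0 < t -> t < d -> 0 < dphi t.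
  move=> t0 td; have := Hd t; rewrite -ball_normE /= sub0r normrN gtr0_norm//.
  move=> /(_ td); rewrite gt_eqF//= => /(_ isT).
  rewrite addr0 [t%:A]mulr1 d0 subr0 ltr_norml => /andP[_].
  rewrite ltrBlDl ltrDr => H.
  have : 0 < t * (t^-1 *: dphi t) by rewrite mulr_gt0.
  by rewrite [t^-1 *: _]/(t^-1 * _) mulVKf// gt_eqF.
pose m := Num.min d r / 2.
have m0 : 0 < m by rewrite divr_gt0// lt_min dp0 r0.
have md : m < d.
  by rewrite ltr_pdivrMr// (le_lt_trans (_ : _ <= d))// ?ge_min ?lexx// ltr_pMr// ltr1n.
have mr : m < r.
  rewrite ltr_pdivrMr// (le_lt_trans (_ : _ <= r))// ?ge_min ?lexx ?orbT//.
  by rewrite ltr_pMr// ltr1n.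
have nm t : 0 <= t -> t <= m -> `|t| < r.
  by move=> t0 tm; rewrite ger0_norm// (le_lt_trans tm).
have dpi t : t \in `]0, m[%R -> is_derive t 1 phi (dphi t).
  by rewrite in_itv /= => /andP[t0 tm]; apply/dp/nm; exact: ltW.
have cont : {within `[0, m], continuous phi}.
  apply: continuous_in_subspaceT => t.
  rewrite inE /= in_itv /= => /andP[t0 tm].
  apply: differentiable_continuous; apply/derivable1_diffP.
  by have [] := dp t (nm t t0 tm).
have [c] := MVT m0 dpi cont.
rewrite in_itv /= subr0 => /andP[c0 cm] E.
have : 0 < phi m - phi 0 by rewrite E mulr_gt0// pos// (lt_trans cm).
by rewrite subr_gt0 ltNge hmax// nm// ltW.
Qed.

End Line.

Section C1.
Variables (R : realType) (n : nat).
Local Notation V := 'rV[R]_n.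
Local Notation e_ a := (delta_mx 0 a : V).
Implicit Types (f g : V -> R) (x y h v : V) (a b : 'I_n) (D : set V).

Lemma coord_le_norm v a : `|v 0 a| <= `|v|.
Proof.
rewrite [leRHS]/Num.Def.normr/= mx_normrE.
exact: (le_bigmax _ (fun ij => `|v ij.1 ij.2|) (0, a)).
Qed.

Lemma norm_lt_coord v (e : R) : 0 < e -> (forall a, `|v 0 a| < e) -> `|v| < e.
Proof.
move=> e0 H; rewrite [ltLHS]/Num.Def.normr/= mx_normrE.
by apply/bigmax_ltP; split => // -[i a] _ /=; rewrite ord1.
Qed.

(** Change one coordinate of the increment at a time, and apply the mean value
theorem to each step. *)
Lemma increment_bound g x (r e : R) : 0 <= e ->
  (forall y a, `|y - x| < r -> pder g y a) ->
  (forall y a, `|y - x| < r -> `|partial a g y| <= e) ->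
  forall h, `|h| < r -> `|g (x + h) - g x| <= e * \sum_a `|h 0 a|.
Proof.
move=> e0 dg bg h hr.
have r0 : 0 < r by rewrite (le_lt_trans _ hr).
pose hk k := \row_a (if (a < k)%N then h 0 a else 0) : V.
suff H k : (k <= n)%N ->
    `|g (x + hk k) - g x| <= e * \sum_(a < n | (a < k)%N) `|h 0 a|.
  have := H n (leqnn n); have -> : hk n = h.
    by apply/rowP => a; rewrite !mxE ltn_ord.
  by rewrite (eq_bigl xpredT)// => a; rewrite ltn_ord.
elim: k => [_|k IH kn].
  have -> : hk 0%N = 0 by apply/rowP => a; rewrite !mxE.
  by rewrite addr0 subrr normr0 mulr_ge0// sumr_ge0.
pose a := Ordinal kn.
have hS : hk k.+1 = hk k + h 0 a *: e_ a.
  apply/rowP => b; rewrite !mxE eqxx /= -val_eqE /= ltnS leq_eqVlt.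
  case: (eqVneq (b : nat) k) => [bk|bk] /=; last by rewrite mulr0 addr0.
  by rewrite bk ltnn add0r mulr1; congr (h 0 _); exact: val_inj.
have inr t : `|t| <= `|h 0 a| -> `|x + hk k + t *: e_ a - x| < r.
  move=> ta; rewrite addrAC [x + _ - x]addrAC subrr add0r.
  apply: norm_lt_coord => // b; rewrite !mxE eqxx /= -val_eqE /=.
  case: (eqVneq (b : nat) k) => [bk|bk] /=.
    rewrite bk ltnn add0r mulr1; apply: le_lt_trans ta _.
    exact: le_lt_trans (coord_le_norm h a) hr.
  rewrite mulr0 addr0; case: ifP => _; last by rewrite normr0.
  exact: le_lt_trans (coord_le_norm h b) hr.
have [|c ca E] := @mvt_unsigned R (fun t => g (x + hk k + t *: e_ a))
    (fun t => partial a g (x + hk k + t *: e_ a)) (h 0 a).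
  by move=> t ta; apply: line_is_derive; apply: dg; exact: inr.
rewrite (bigD1 a)/= ?ltnSn// mulrDr [leRHS]addrC.
have -> : \sum_(i < n | (i < k.+1)%N && (i != a)) `|h 0 i|
   = \sum_(i < n | (i < k)%N) `|h 0 i|.
  apply: eq_bigl => i; rewrite -val_eqE /= ltnS leq_eqVlt.
  by case: eqVneq => [->|_] /=; rewrite ?ltnn ?andbT.
have -> : g (x + hk k.+1) - g x = (g (x + hk k) - g x) +
    (g (x + hk k + h 0 a *: e_ a) - g (x + hk k + 0 *: e_ a)).
  by rewrite hS scale0r addr0 addrA; ring.
apply: le_trans (ler_normD _ _) _; apply: lerD; first exact/IH/ltnW.
by rewrite E normrM ler_wpM2r// bg// inr.
Qed.

Lemma partial_coord x a b : partial a (fun y => y 0 b) x = (a == b)%:R.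
Proof.
have dd : derivable (fun y : V => y) x (e_ a) by exact: derivable_id.
have := derive_mx dd; rewrite derive_id => /matrixP/(_ 0 b).
by rewrite !mxE eqxx /= eq_sym => ->.
Qed.

Lemma pder_coord x a b : pder (fun y => y 0 b) x a.
Proof. exact: (ck_pder a (@ck_coord R n 1 setT b openT)). Qed.

(** Continuous partial derivatives imply that directional derivatives are
linear in the direction: subtract the candidate differential L, so that the
partial derivatives of the difference g become small near x, and apply
increment_bound. *)
Lemma c1_is_derive D f x v : open D -> ck 1 D f -> D x ->
  is_derive x v f (\sum_a v 0 a * partial a f x).
Proof.
move=> oD hf Dx.
have [r0 r00 Dr] := open_ball_norm oD Dx.
pose L y := \sum_a y 0 a * partial a f x : R.
suff H : (fun h : R => h^-1 *: ((f \o shift x) (h *: v) - f x)) @ 0^' --> L v.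
  by split; [apply/cvg_ex; exists (L v)|exact: cvg_lim H].
pose g y := f y - L y.
have pL y a : pder L y a /\ partial a L y = partial a f x.
  have [|p1 p2] := @partial_sum R n _ (index_enum 'I_n) xpredT
      (fun b y => y 0 b * partial b f x) y a.
    by move=> b _; apply: derivableM; [exact: pder_coord|exact: derivable_cst].
  split => //; apply: etrans p2 _.
  have pE b : partial a (fun y => y 0 b * partial b f x) y
      = (a == b)%:R * partial b f x.
    have dc : pder (cst (partial b f x)) y a by exact: derivable_cst.
    rewrite (partialM (@pder_coord y a b) dc).
    by rewrite partial_cst partial_coord mulr0 add0r.
  rewrite (bigD1 a)//= big1 ?addr0; first by rewrite pE eqxx mul1r.
  by move=> b ba; rewrite pE eq_sym (negPf ba) mul0r.
pose s := 1 + \sum_a `|v 0 a|.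
have s0 : 0 < s by rewrite ltr_pwDl// sumr_ge0.
apply/cvgrPdist_le => e e0.
have e1 : 0 < e / s by rewrite divr_gt0.
have [d d0 Hd] : exists2 d : R, 0 < d & forall y a, `|y - x| < d ->
    `|partial a f y - partial a f x| < e / s.
  have /all_sig2[d d0 Hd] : forall a, {d : R | 0 < d & forall y, `|y - x| < d ->
      `|partial a f y - partial a f x| < e / s}.
    move=> a; apply/cid2; apply: continuous_eps => //.
    exact: ck_continuous (ck_partial a hf) Dx.
  exists (\big[Num.min/1]_a d a).
    by apply: lt_bigmin => // a _; exact: d0.
  move=> y a /lt_le_trans H; apply: Hd; apply: H; exact: bigmin_le.
pose r := Num.min r0 d.
have rp : 0 < r by rewrite lt_min r00 d0.
have dg y a : `|y - x| < r -> pder g y a.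
  rewrite lt_min => /andP[yr _].
  have q1 := ck_pder a hf (Dr _ yr); have q2 := (pL y a).1.
  have q3 := derivableB q1 q2.
  exact: q3.
have bg y a : `|y - x| < r -> `|partial a g y| <= e / s.
  rewrite lt_min => /andP[yr yd].
  have [p1 p2] := pL y a.
  rewrite (partialB (ck_pder a hf (Dr _ yr)) p1) p2.
  exact/ltW/Hd.
have := increment_bound (ltW e1) dg bg => B.
have v1 : 0 < 1 + `|v| by rewrite ltr_pwDl.
rewrite near_withinE; apply/nbhs_ballP; exists (r / (1 + `|v|)).
  by rewrite /= divr_gt0.
move=> t; rewrite -ball_normE /= sub0r normrN => tr t0.
have tv : `|t *: v| < r.
  rewrite normrZ (le_lt_trans (_ : _ <= `|t| * (1 + `|v|)))//.
    by rewrite ler_wpM2l// lerDr.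
  by rewrite -ltr_pdivlMr.
have E : L v - t^-1 *: (f (t *: v + x) - f x) = - t^-1 * (g (x + t *: v) - g x).
  have -> : g (x + t *: v) - g x = f (t *: v + x) - f x - t * L v.
    rewrite /g [t *: v + x]addrC.
    have -> : L (x + t *: v) = L x + t * L v.
      rewrite /L mulr_sumr -big_split /=; apply: eq_bigr => a _.
      by rewrite !mxE; ring.
    ring.
  have alg (p q : R) : q - t^-1 * p = - t^-1 * (p - t * q) by field.
  exact: alg.
rewrite E normrM normrN normfV.
apply: le_trans (_ : `|t|^-1 * (e / s * \sum_a `|(t *: v) 0 a|) <= _).
  by rewrite ler_wpM2l// ?invr_ge0//; exact: B.
have -> : \sum_a `|(t *: v) 0 a| = `|t| * \sum_a `|v 0 a|.
  by rewrite mulr_sumr; apply: eq_bigr => a _; rewrite mxE normrM.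
have tn : `|t| != 0 by rewrite normr_eq0.
rewrite [_ * (_ * _)](_ : _ = e * ((\sum_a `|v 0 a|) / s)); last first.
  by field; rewrite tn gt_eqF.
by rewrite ler_piMr// ?(ltW e0)// ler_pdivrMr// mul1r lerDr.
Qed.

End C1.

Section C2.
Variables (R : realType) (n : nat).
Local Notation V := 'rV[R]_n.
Local Notation e_ a := (delta_mx 0 a : V).
Implicit Types (f g : V -> R) (x y h v : V) (a b : 'I_n) (D : set V).

Lemma norm_delta_le (a : 'I_n) : `|e_ a| <= 1.
Proof.
rewrite leNgt; apply/negP => H.
suff : `|e_ a| < `|e_ a| by rewrite ltxx.
apply: norm_lt_coord; first exact: lt_trans H.
move=> b; rewrite mxE; apply: le_lt_trans H.
by case: (_ && _); rewrite ?normr1 ?normr0.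
Qed.

(** The mixed second difference is symmetric in a and b, while two applications
of the mean value theorem express it by an iterated partial derivative at a
nearby point.  This is what makes the partial derivatives commute. *)
Lemma mixed_difference D f x a b (r t : R) : ck 2 D f ->
  (forall y, `|y - x| < r -> D y) -> 0 < t -> t + t < r ->
  exists2 y, `|y - x| <= t + t &
    f (x + t *: e_ a + t *: e_ b) - f (x + t *: e_ a) - f (x + t *: e_ b) + f x
    = partial b (partial a f) y * t * t.
Proof.
move=> hf Dr t0 tr.
have near_x c d : `|c| <= `|t| -> `|d| <= `|t| ->
    `|x + c *: e_ a + d *: e_ b - x| <= t + t.
  rewrite (gtr0_norm t0) => ct dt.
  rewrite [_ - x]addrAC [x + _ - x]addrAC subrr add0r.
  apply: le_trans (ler_normD _ _) _; rewrite !normrZ.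
  by apply: lerD; rewrite -[t]mulr1 ler_pM// norm_delta_le.
have inD c d : `|c| <= `|t| -> `|d| <= `|t| -> D (x + c *: e_ a + d *: e_ b).
  by move=> ct dt; apply: Dr; apply: le_lt_trans tr; exact: near_x.
have n00 : `|0 : R| <= `|t| by rewrite normr0.
have inD0 c : `|c| <= `|t| -> D (x + c *: e_ a).
  by move=> ct; have := inD c 0 ct n00; rewrite scale0r addr0.
have [|c ct E1] := @mvt_unsigned R
    (fun s => f (x + t *: e_ b + s *: e_ a) - f (x + s *: e_ a))
    (fun s => partial a f (x + t *: e_ b + s *: e_ a)
              - partial a f (x + s *: e_ a)) t.
  move=> s st; apply: is_deriveB; apply: line_is_derive.
    by apply: (ck_pder a hf); rewrite addrAC; exact: inD.
  by apply: (ck_pder a hf); exact: inD0.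
have [|d dt E2] := @mvt_unsigned R (fun s => partial a f (x + c *: e_ a + s *: e_ b))
    (fun s => partial b (partial a f) (x + c *: e_ a + s *: e_ b)) t.
  move=> s st; apply: line_is_derive.
  by apply: (ck_pder b (ck_partial a hf)); exact: inD.
exists (x + c *: e_ a + d *: e_ b); first exact: near_x.
have sw (s u : R) : x + s *: e_ a + u *: e_ b = x + u *: e_ b + s *: e_ a.
  exact: addrAC.
by rewrite -E2 !sw scale0r addr0 -E1 !scale0r !addr0; ring.
Qed.

Lemma partialC D f x a b : open D -> ck 2 D f -> D x ->
  partial a (partial b f) x = partial b (partial a f) x.
Proof.
move=> oD hf Dx; have [r r0 Dr] := open_ball_norm oD Dx.
apply/eqP; rewrite -subr_eq0 -normr_eq0; apply/negPn/negP => ne.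
set S := `|_| in ne.
have S0 : 0 < S by rewrite lt_neqAle eq_sym ne normr_ge0.
have S2 : 0 < S / 2 by rewrite divr_gt0.
have cab : {for x, continuous (partial a (partial b f))}.
  exact: ck_continuous (ck_partial a (ck_partial b hf)) Dx.
have cba : {for x, continuous (partial b (partial a f))}.
  exact: ck_continuous (ck_partial b (ck_partial a hf)) Dx.
have [d1 d10 H1] := continuous_eps cab S2.
have [d2 d20 H2] := continuous_eps cba S2.
pose t := Num.min r (Num.min d1 d2) / 3.
have m0 : 0 < Num.min r (Num.min d1 d2) by rewrite !lt_min r0 d10 d20.
have t0 : 0 < t by rewrite divr_gt0.
have : t + t < Num.min r (Num.min d1 d2) by rewrite /t; lra.
rewrite !lt_min => /and3P[tr td1 td2].
have [y yx E1] := mixed_difference a b hf Dr t0 tr.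
have [z zx E2] := mixed_difference b a hf Dr t0 tr.
have E : partial b (partial a f) y = partial a (partial b f) z.
  apply: (mulIf (lt0r_neq0 t0)); apply: (mulIf (lt0r_neq0 t0)).
  apply: etrans (esym E1) _; apply: etrans E2.
  have -> : x + t *: e_ b + t *: e_ a = x + t *: e_ a + t *: e_ b.
    exact: addrAC.
  by congr (_ + _); exact: addrAC.
have := H1 z (le_lt_trans zx td1); have := H2 y (le_lt_trans yx td2).
rewrite E => h2 h1.
have tri (p q w : R) : `|w - p| < S / 2 -> `|w - q| < S / 2 -> `|p - q| < S.
  move=> wp wq; have := ltrD wp wq; rewrite -splitr; apply: le_lt_trans.
  by rewrite (distrC w p); exact: ler_distD.
by have := tri _ _ _ h1 h2; rewrite ltxx.
Qed.

(** Restrict f to the line through x in a given direction. *)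
Lemma second_derivative_test D f x v : open D -> ck 2 D f -> D x ->
  (forall y, D y -> f y <= f x) ->
  (forall a, partial a f x = 0) /\
  \sum_a \sum_b v 0 a * v 0 b * partial a (partial b f) x <= 0.
Proof.
move=> oD hf Dx fmax.
suff H (w : V) : \sum_a w 0 a * partial a f x = 0 /\
    \sum_a w 0 a * (\sum_b w 0 b * partial a (partial b f) x) <= 0.
  split.
    move=> a; have [+ _] := H (e_ a).
    rewrite (bigD1 a)//= mxE !eqxx mul1r big1 ?addr0// => b ba.
    by rewrite mxE (negPf ba) mul0r.
  have [_] := H v; congr (_ <= _); apply: eq_bigr => a _.
  by rewrite mulr_sumr; apply: eq_bigr => b _; rewrite mulrA.
have [r0 r00 Dr] := open_ball_norm oD Dx.
have w0 : 0 < 1 + `|w| by rewrite ltr_pwDl.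
pose r := r0 / (1 + `|w|).
have r_gt0 : 0 < r by rewrite divr_gt0.
have inD t : `|t| < r -> D (x + t *: w).
  rewrite ltr_pdivlMr// => tr; apply: Dr.
  rewrite addrAC subrr add0r normrZ; apply: le_lt_trans tr.
  by rewrite ler_wpM2l// lerDr.
pose df y := \sum_a w 0 a * partial a f y.
have hdf : ck 1 D df.
  apply: ck_sum => // a _.
  exact: (ckM oD (@ck_cst R n 1 D (w 0 a)) (ck_partial a hf)).
have dphi t : `|t| < r -> is_derive (t : R) 1 (fun s => f (x + s *: w))
    (df (x + t *: w)).
  move=> tr; have [d1 d2] := c1_is_derive w oD (ckW hf) (inD t tr).
  by rewrite /df -d2; exact: line_is_derive.
have n0 : `|0 : R| < r by rewrite normr0.
have ddphi : is_derive (0 : R) 1 (fun s => df (x + s *: w))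
    (\sum_a w 0 a * (\sum_b w 0 b * partial a (partial b f) x)).
  have [d1 d2] := c1_is_derive w oD hdf (inD 0 n0).
  have := line_is_derive d1; rewrite d2 scale0r addr0.
  congr is_derive; apply: eq_bigr => a _; congr (_ * _).
  have pp b : pder (fun y => w 0 b * partial b f y) x a.
    exact: (ck_pder a (ckM oD (@ck_cst R n 1 D (w 0 b)) (ck_partial b hf)) Dx).
  have [_ E] := @partial_sum R n _ (index_enum 'I_n) xpredT
      (fun b y => w 0 b * partial b f y) x a (fun b _ => pp b).
  apply: etrans E _; apply: eq_bigr => b _.
  have dc : pder (cst (w 0 b)) x a by exact: derivable_cst.
  rewrite (partialM dc (ck_pder a (ck_partial b hf) Dx)).
  by rewrite partial_cst mul0r addr0.
have := second_derivative_max r_gt0 dphi ddphi _.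
rewrite scale0r addr0; apply => t /inD; exact: fmax.
Qed.

End C2.

(** * Positive definite matrices *)

Section PosDef.
Variable R : rcfType.

Definition qform n (G : 'M[R]_n) (v : 'rV[R]_n) : R := (v *m G *m v^T) 0 0.

Lemma qformE n (G : 'M[R]_n) v :
  qform G v = \sum_i \sum_j v 0 i * v 0 j * G i j.
Proof.
rewrite /qform mxE exchange_big /=; apply: eq_bigr => j _.
rewrite !mxE mulr_suml; apply: eq_bigr => i _; ring.
Qed.

Definition posdef n (G : 'M[R]_n) : Prop :=
  G^T = G /\ forall v, v != 0 -> 0 < qform G v.

Lemma posdef_ge0 n (G : 'M[R]_n) v : posdef G -> 0 <= qform G v.
Proof.
move=> [_ Gp]; have [->|/Gp/ltW//] := eqVneq v 0.
by rewrite /qform !mul0mx mxE.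
Qed.

(** Gram-Schmidt orthogonalization in matrix form: the Schur complement S of
the upper left entry is again positive definite, and L clears the first row
and column. *)
Lemma posdef_frame n (G : 'M[R]_n) : posdef G ->
  exists P : 'M[R]_n, P *m G *m P^T = 1%:M.
Proof.
elim: n G => [|n IH] G [Gs Gp]; first by exists 0; apply/matrixP => -[].
rewrite -[n.+1]/(1 + n)%N in G Gs Gp *.
pose a := G 0 0; pose b := ursubmx G : 'rV[R]_n; pose C := drsubmx G.
have ulE : ulsubmx G = a%:M.
  by rewrite [LHS]mx11_scalar !mxE; congr (G _ _)%:M; exact: val_inj.
have dlE : dlsubmx G = b^T by rewrite -[LHS]trmxK trmx_dlsub Gs.
have GE : G = block_mx a%:M b b^T C by rewrite -{1}[G]submxK ulE dlE.
have Cs : C^T = C by rewrite /C trmx_drsub Gs.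
have a0 : 0 < a.
  have := Gp (delta_mx 0 0); rewrite /qform -rowE trmx_delta -colE !mxE; apply.
  by apply/eqP => /matrixP/(_ 0 0)/eqP; rewrite !mxE eqxx oner_eq0.
pose L : 'M[R]_(1 + n) := block_mx 1%:M 0 ((- a^-1) *: b^T) 1%:M.
pose S := C - a^-1 *: (b^T *m b).
have LG : L *m G *m L^T = block_mx a%:M 0 0 S.
  rewrite GE /L tr_block_mx !mulmx_block !trmx0 !trmx1 !mul1mx !mul0mx !mulmx0.
  rewrite !mulmx1 !addr0 ?add0r linearZ /= trmxK; congr block_mx.
  - rewrite mul_scalar_mx scalerA mulrN mulfV ?gt_eqF//.
    by rewrite scaleN1r addrC subrr.
  - by rewrite mul_mx_scalar scalerA mulrN mulfV ?gt_eqF// scaleN1r addrC subrr.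
  - rewrite mul_mx_scalar scalerA mulrN mulfV ?gt_eqF// scaleN1r.
    rewrite [- b^T + _]addrC subrr mul0mx add0r.
    by rewrite /S -scalemxAl scaleNr addrC.
have [|P' PS] := IH S.
  split; first by rewrite /S linearB linearZ /= trmx_mul trmxK Cs.
  move=> w w0; have := Gp (row_mx 0 w *m L).
  have -> : qform G (row_mx 0 w *m L) = qform S w.
    rewrite /qform trmx_mul !mulmxA -(mulmxA _ L) -(mulmxA _ _ L^T) LG.
    by rewrite tr_row_mx mul_row_block mul_row_col !mul0mx !mulmx0 !add0r mul0mx add0r.
  apply; apply: contra_neq w0 => /(congr1 rsubmx).
  by rewrite /L mul_row_block row_mxKr mul0mx add0r mulmx1 linear0.
pose s := (Num.sqrt a)^-1.
have s2 : s * a * s = 1.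
  have sa : Num.sqrt a != 0 by rewrite gt_eqF// sqrtr_gt0.
  by rewrite -[a in s * a]sqr_sqrtr ?ltW// /s; field.
exists (block_mx s%:M 0 0 P' *m L).
rewrite trmx_mul !mulmxA -(mulmxA _ L) -(mulmxA _ _ L^T) LG.
rewrite tr_block_mx !mulmx_block !trmx0 tr_scalar_mx.
rewrite !mul0mx !mulmx0 !addr0 !add0r !mul0mx ?addr0 ?add0r PS.
by rewrite -!scalar_mxM s2 -scalar_mx_block.
Qed.

Lemma posdef_inv_frame n (G : 'M[R]_n) : posdef G ->
  G \in unitmx /\ exists P : 'M[R]_n, invmx G = P^T *m P.
Proof.
move=> /posdef_frame[P PG].
have [PU _] : P \in unitmx /\ G *m P^T \in unitmx.
  by apply: mulmx1_unit; rewrite mulmxA.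
have [_ PTU] : P *m G \in unitmx /\ P^T \in unitmx by exact: mulmx1_unit.
have E : G *m (P^T *m P) = 1%:M.
  have : P *m G *m P^T *m P = P by rewrite PG mul1mx.
  move=> /(congr1 (mulmx (invmx P))); rewrite -!mulmxA mulKmx// => ->.
  by rewrite mulVmx.
have [GU _] := mulmx1_unit E; split => //; exists P.
by rewrite -[RHS](mulKmx GU) E mulmx1.
Qed.

Lemma posdef_factor n (A : 'M[R]_n) : posdef A ->
  exists P : 'M[R]_n, A = P^T *m P.
Proof.
move=> /posdef_frame[P PA].
have [PU _] : P \in unitmx /\ A *m P^T \in unitmx.
  by apply: mulmx1_unit; rewrite mulmxA.
exists (invmx P)^T; rewrite trmxK.
rewrite -[A](mulmxK (_ : P^T \in unitmx)) ?unitmx_tr//.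
by rewrite -[A *m _](mulKmx PU) (mulmxA P A) PA mulmx1 trmx_inv.
Qed.

Lemma posdef_inv n (G : 'M[R]_n) : posdef G -> posdef (invmx G).
Proof.
move=> Gp; have [GU _] := posdef_inv_frame Gp; have [Gs G0] := Gp.
split; first by rewrite trmx_inv Gs.
move=> v v0; have := G0 (v *m invmx G).
rewrite /qform trmx_mul trmx_inv Gs mulmxKV// mulmxA; apply.
by apply: contra_neq v0 => /(congr1 (mulmxr G)); rewrite /= mulmxKV// mul0mx.
Qed.

(** Contracting with P^T P evaluates a quadratic form on the rows of P.  With
posdef_factor this reduces the sign of a trace to signs of quadratic forms. *)
Lemma factor_contraction n (P B : 'M[R]_n) :
  \sum_i \sum_j (P^T *m P) i j * B i j = \sum_k qform B (row k P).
Proof.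
transitivity (\sum_i \sum_j \sum_k P k i * P k j * B i j).
  apply: eq_bigr => i _; apply: eq_bigr => j _; rewrite mxE mulr_suml.
  by apply: eq_bigr => k _; rewrite mxE.
rewrite (eq_bigr (fun i => \sum_k \sum_j P k i * P k j * B i j)); last first.
  by move=> i _; exact: exchange_big.
rewrite exchange_big /=; apply: eq_bigr => k _; rewrite qformE.
by apply: eq_bigr => i _; apply: eq_bigr => j _; rewrite !mxE.
Qed.

Lemma posdef_contraction_le0 n (A B : 'M[R]_n) : posdef A ->
  (forall v, qform B v <= 0) -> \sum_i \sum_j A i j * B i j <= 0.
Proof.
move=> /posdef_factor[P ->] B0; rewrite factor_contraction.
by apply: sumr_le0 => k _.
Qed.

Lemma posdef_contraction_ge0 n (A B : 'M[R]_n) : posdef A ->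
  (forall v, 0 <= qform B v) -> 0 <= \sum_i \sum_j A i j * B i j.
Proof.
move=> /posdef_factor[P ->] B0; rewrite factor_contraction.
by apply: sumr_ge0 => k _.
Qed.

End PosDef.

(** * Conformal fields in a chart *)

Section CkMatrix.
Variables (R : realType) (n : nat).
Local Notation V := 'rV[R]_n.

Lemma ck_det k m (D : set V) (A : V -> 'M[R]_m) : open D ->
  (forall i j, ck k D (fun x => A x i j)) -> ck k D (fun x => \det (A x)).
Proof.
move=> oD hA; apply: ck_sum => // s _; apply: ckM => //; first exact: ck_cst.
exact: ck_prod.
Qed.

(** Cramer's rule: the entries of the inverse are rational functions of those
of the matrix. *)
Lemma ck_invmx k m (D : set V) (A : V -> 'M[R]_m) i j : open D ->
  (forall i j, ck k D (fun x => A x i j)) ->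
  (forall x, D x -> A x \in unitmx) -> ck k D (fun x => invmx (A x) i j).
Proof.
move=> oD hA AU.
have : ck k D (fun x => (\det (A x))^-1 * cofactor (A x) j i).
  apply: ckM => //.
    apply: ckV => // [x /AU|]; first by rewrite unitmxE unitfE.
    exact: ck_det.
  apply: ckM => //; first exact: ck_cst.
  apply: ck_det => // i' j'.
  by apply: ck_eq (hA (lift j i') (lift i j')) => // x _; rewrite !mxE.
by apply: ck_eq => // x /AU xU; rewrite /invmx xU !mxE.
Qed.

End CkMatrix.

Section ChartGeometry.
Variables (R : realType) (n : nat).
Local Notation V := 'rV[R]_n.
Variables (D : set V) (G : V -> 'M[R]_n) (X : V -> 'rV[R]_n) (mu : V -> R).
(* On a chart with domain D, X is a conformal field with factor mu, that is,
   L_X G = mu G.  All objects are smooth, that is, of class C^k for all k. *)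
Hypothesis oD : open D.
Hypothesis hG : forall a b k, ck k D (fun x => G x a b).
Hypothesis hX : forall a k, ck k D (fun x => X x 0 a).
Hypothesis Gp : forall x, D x -> posdef (G x).
Hypothesis hmu : forall k, ck k D mu.
Hypothesis Lmu : forall x, D x -> lie_derivative X G x = mu x *: G x.
Implicit Types (x : V) (a b c d e : 'I_n).

Local Notation Gam := (christoffel G).
Local Notation xi a := (fun x : V => X x 0 a).
Local Notation gg a b := (fun x : V => G x a b).
Local Notation HH a b := (fun x : V => invmx (G x) a b).

Lemma ck_pderivable f x a : (forall k, ck k D f) -> D x -> pder f x a.
Proof. by move=> hf; exact: (ck_pder a (hf 1%N)). Qed.

Lemma partialM_ck f h x a : (forall k, ck k D f) -> (forall k, ck k D h) -> D x ->
  partial a (fun y => f y * h y) x = f x * partial a h x + partial a f x * h x.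
Proof. by move=> hf hh Dx; apply: partialM; exact: ck_pderivable. Qed.

Lemma partialD_ck f h x a : (forall k, ck k D f) -> (forall k, ck k D h) -> D x ->
  partial a (fun y => f y + h y) x = partial a f x + partial a h x.
Proof. by move=> hf hh Dx; apply: partialD; exact: ck_pderivable. Qed.

Lemma partial_sum_ck (F : 'I_n -> V -> R) x a : (forall i k, ck k D (F i)) -> D x ->
  partial a (fun y => \sum_i F i y) x = \sum_i partial a (F i) x.
Proof.
by move=> hF Dx; have [] := @partial_sum R n _ (index_enum 'I_n) xpredT F x a
  (fun i _ => ck_pderivable (hF i) Dx).
Qed.

Lemma ck_inverse_metric a b k : ck k D (HH a b).
Proof.
apply: ck_invmx => // x Dx.
by have [] := posdef_inv_frame (Gp Dx).
Qed.

Lemma ck_christoffel c a b k : ck k D (Gam c a b).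
Proof.
apply: ckM => //; first exact: ck_cst.
apply: ck_sum => // d _; apply: ckM => //; first exact: ck_inverse_metric.
apply: ckB => //; last exact: (ck_partial _ (hG _ _ _)).
by apply: ckD => //; exact: (ck_partial _ (hG _ _ _)).
Qed.

Lemma sum_delta e (K : 'I_n -> R) : \sum_d (e == d)%:R * K d = K e.
Proof.
rewrite (bigD1 e)//= eqxx mul1r big1 ?addr0// => d de.
by rewrite eq_sym (negPf de) mul0r.
Qed.

Lemma metricC x a b : D x -> G x a b = G x b a.
Proof. by move=> /Gp[Gs _]; rewrite -[in RHS]Gs mxE. Qed.

Lemma inverse_metricC x a b : D x -> invmx (G x) a b = invmx (G x) b a.
Proof. by move=> /Gp/posdef_inv[Hs _]; rewrite -[in RHS]Hs mxE. Qed.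

Lemma inverse_metric_mulr x a b : D x -> \sum_c G x a c * invmx (G x) c b = (a == b)%:R.
Proof.
move=> Dx; have [GU _] := posdef_inv_frame (Gp Dx).
by have /matrixP/(_ a b) := mulmxV GU; rewrite !mxE.
Qed.

Lemma partial_metricC x c a b : D x -> partial c (gg a b) x = partial c (gg b a) x.
Proof. by move=> Dx; apply: eq_partial oD _ Dx => y; exact: metricC. Qed.

Lemma christoffelC x c a b : D x -> Gam c a b x = Gam c b a x.
Proof.
move=> Dx; rewrite /christoffel; congr (_ * _); apply: eq_bigr => d _.
by rewrite (partial_metricC d a b Dx) [partial a _ x + _]addrC.
Qed.

(** The Christoffel symbols of the first kind. *)
Definition lowGam a d b x : R := \sum_c Gam c a d x * G x c b.

Lemma lowGamE a d b x : D x -> lowGam a d b x =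
  2^-1 * (partial a (gg b d) x + partial d (gg b a) x - partial b (gg a d) x).
Proof.
move=> Dx; rewrite /lowGam /christoffel.
pose K e := partial a (gg e d) x + partial d (gg e a) x - partial e (gg a d) x.
transitivity (2^-1 * \sum_e (\sum_c G x b c * invmx (G x) c e) * K e).
  rewrite mulr_sumr.
  under eq_bigr => c _ do rewrite -mulrA mulr_suml mulr_sumr.
  rewrite exchange_big /=; apply: eq_bigr => e _.
  rewrite mulr_suml mulr_sumr; apply: eq_bigr => c _.
  by rewrite (metricC c b Dx) -/(K e); ring.
congr (_ * _); rewrite -[RHS](sum_delta b K).
by apply: eq_bigr => e _; rewrite inverse_metric_mulr.
Qed.

Lemma lowGamC a d b x : D x -> lowGam a d b x = lowGam d a b x.
Proof. by move=> Dx; apply: eq_bigr => c _; rewrite christoffelC. Qed.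

Lemma metric_compatible a b c x : D x ->
  partial a (gg b c) x = lowGam a b c x + lowGam a c b x.
Proof.
move=> Dx; rewrite !lowGamE// (partial_metricC a c b Dx) (partial_metricC b a c Dx).
by rewrite (partial_metricC c b a Dx); field.
Qed.

(** The components (nabla_a X)^c. *)
Definition cov a c x : R :=
  partial a (xi c) x + \sum_b X x 0 b * Gam c a b x.

(** The components T_ab = nabla_a X_b. *)
Definition covl a b x : R := \sum_c cov a c x * G x c b.

Lemma ck_cov a c k : ck k D (cov a c).
Proof.
apply: ckD => //; first exact: (ck_partial a (hX c _)).
by apply: ck_sum => // b _; apply: ckM => //; exact: ck_christoffel.
Qed.

Lemma ck_covl a b k : ck k D (covl a b).
Proof. by apply: ck_sum => // c _; apply: ckM => //; exact: ck_cov. Qed.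

(** In this form each derivative of X is separated from the Christoffel
symbols, so that metric_compatible can be applied. *)
Lemma covlE a b x : covl a b x =
  \sum_c partial a (xi c) x * G x c b + \sum_d X x 0 d * lowGam a d b x.
Proof.
rewrite /covl /cov; under eq_bigr => c _ do rewrite mulrDl.
rewrite big_split /=; congr (_ + _).
under eq_bigr => c _ do rewrite mulr_suml.
rewrite exchange_big /=; apply: eq_bigr => d _.
by rewrite mulr_sumr; apply: eq_bigr => c _; rewrite mulrA.
Qed.

Lemma lie_derivative_cov a b x : D x ->
  lie_derivative X G x a b = covl a b x + covl b a x.
Proof.
move=> Dx; rewrite !covlE addrACA -!big_split /= mxE; apply: eq_bigr => c _.
rewrite (metric_compatible c a b Dx) (lowGamC a c b Dx).
by rewrite (lowGamC b c a Dx) (metricC a c Dx); ring.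
Qed.

Lemma conformal a b x : D x -> covl a b x + covl b a x = mu x * G x a b.
Proof. by move=> Dx; rewrite -lie_derivative_cov// Lmu// mxE. Qed.

(** The squared length u = |X|^2. *)
Definition usq x : R := qform (G x) (X x).

Lemma usqE x : usq x = \sum_b \sum_c X x 0 b * X x 0 c * G x b c.
Proof. exact: qformE. Qed.

Lemma ck_usq k : ck k D usq.
Proof.
have : ck k D (fun x => \sum_b \sum_c X x 0 b * X x 0 c * G x b c).
  apply: ck_sum => // b _; apply: ck_sum => // c _.
  by apply: ckM => //; apply: ckM.
by apply: ck_eq => // x _; rewrite usqE.
Qed.

Lemma d_usq a x : D x -> partial a usq x = 2 * \sum_b covl a b x * X x 0 b.
Proof.
move=> Dx.
have -> : partial a usq x =
    \sum_b \sum_c (partial a (xi b) x * X x 0 c * G x b c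
      + X x 0 b * partial a (xi c) x * G x b c
      + X x 0 b * X x 0 c * (lowGam a b c x + lowGam a c b x)).
  have -> : usq = (fun x => \sum_b \sum_c X x 0 b * X x 0 c * G x b c).
    by apply/funext => y; exact: usqE.
  have hXX b c k : ck k D (fun y => X y 0 b * X y 0 c) by apply: ckM.
  have hXXG b c k : ck k D (fun y => X y 0 b * X y 0 c * G y b c) by apply: ckM.
  rewrite partial_sum_ck//; last by move=> b k; apply: ck_sum.
  apply: eq_bigr => b _; rewrite partial_sum_ck//; apply: eq_bigr => c _.
  by rewrite partialM_ck// partialM_ck// metric_compatible//; ring.
have E1 : \sum_b covl a b x * X x 0 b =
    \sum_b \sum_c (partial a (xi b) x * X x 0 c * G x b c
      + X x 0 b * X x 0 c * lowGam a b c x).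
  rewrite exchange_big /=; apply: eq_bigr => c _; rewrite covlE mulrDl.
  rewrite big_split /= !mulr_suml; congr (_ + _); apply: eq_bigr => b _; ring.
have E2 : \sum_b covl a b x * X x 0 b =
    \sum_b \sum_c (X x 0 b * partial a (xi c) x * G x b c
      + X x 0 b * X x 0 c * lowGam a c b x).
  apply: eq_bigr => b _; rewrite covlE mulrDl.
  rewrite big_split /= !mulr_suml; congr (_ + _); apply: eq_bigr => c _.
    by rewrite (metricC b c Dx); ring.
  ring.
rewrite mulr2n mulrDl mul1r {1}E1 E2 -big_split /=; apply: eq_bigr => b _.
by rewrite -big_split /=; apply: eq_bigr => c _; ring.
Qed.

(** Contract the conformal equation with X twice: only the symmetric part of T
matters. *)
Lemma X_usq x : D x -> \sum_a X x 0 a * partial a usq x = mu x * usq x.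
Proof.
move=> Dx; under eq_bigr => a _ do rewrite d_usq//.
have -> : \sum_i X x 0 i * (2 * \sum_b covl i b x * X x 0 b) =
   \sum_a \sum_b X x 0 a * X x 0 b * covl a b x
   + \sum_a \sum_b X x 0 a * X x 0 b * covl b a x.
  rewrite [X in _ + X]exchange_big /= -big_split /=; apply: eq_bigr => a _.
  rewrite -big_split /= !mulr_sumr; apply: eq_bigr => b _; ring.
rewrite -big_split /= usqE mulr_sumr; apply: eq_bigr => a _.
rewrite -big_split mulr_sumr /=; apply: eq_bigr => b _.
by rewrite -mulrDr conformal//; ring.
Qed.

(** The second covariant derivative nabla_c T_ab = nabla_c nabla_a X_b. *)
Definition hessX c a b x : R := partial c (covl a b) x
  - \sum_d Gam d c a x * covl d b x - \sum_d Gam d c b x * covl a d x.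

(** The covariant derivative of the conformal equation, the metric being
parallel. *)
Lemma hessX_conformal c a b x : D x ->
  hessX c a b x + hessX c b a x = partial c mu x * G x a b.
Proof.
move=> Dx.
have S p q : \sum_d Gam d c p x * covl d q x + \sum_d Gam d c p x * covl q d x
    = mu x * lowGam c p q x.
  rewrite -big_split mulr_sumr /=; apply: eq_bigr => d _.
  by rewrite -mulrDr conformal// mulrCA.
have E : partial c (covl a b) x + partial c (covl b a) x
    = partial c mu x * G x a b + mu x * (lowGam c a b x + lowGam c b a x).
  rewrite -partialD_ck//; [|exact: ck_covl|exact: ck_covl].
  have -> : partial c (fun y => covl a b y + covl b a y) x =
      partial c (fun y => mu y * G y a b) x.
    by apply: eq_partial oD _ Dx => y; exact: conformal.
  by rewrite partialM_ck// metric_compatible// addrC.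
move/(canRL (addrK _)): E; rewrite /hessX mulrDr -!S => ->; ring.
Qed.

(** The derivatives of the metric are absorbed by metric compatibility; what
remains is the covariant derivative of cov with its upper index, and a term
that is symmetric in c and a. *)
Lemma hessX_cov c a b x : D x -> hessX c a b x =
  \sum_d (partial c (cov a d) x + \sum_e Gam d c e x * cov a e x) * G x d b
  - \sum_d Gam d c a x * covl d b x.
Proof.
move=> Dx; rewrite /hessX.
have -> : partial c (covl a b) x =
    \sum_d (partial c (cov a d) x + \sum_e Gam d c e x * cov a e x) * G x d b
    + \sum_d Gam d c b x * covl a d x; last by ring.
have hY d k : ck k D (fun y => cov a d y * G y d b) by apply: ckM => //; exact: ck_cov.
rewrite partial_sum_ck//.
have -> : \sum_i partial c (fun y => cov a i y * G y i b) x =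
    \sum_d (partial c (cov a d) x * G x d b + cov a d x * lowGam c d b x
            + cov a d x * lowGam c b d x).
  apply: eq_bigr => d _.
  by rewrite (partialM_ck c (ck_cov a d) (hG d b) Dx) metric_compatible//; ring.
rewrite big_split /=; congr (_ + _).
  rewrite big_split /=; under [RHS]eq_bigr => d _ do rewrite mulrDl.
  rewrite big_split /=; congr (_ + _).
  under [RHS]eq_bigr => d _ do rewrite mulr_suml.
  rewrite exchange_big /=; apply: eq_bigr => e _.
  by rewrite mulr_sumr; apply: eq_bigr => d _; ring.
under eq_bigr => d _ do rewrite mulr_sumr.
rewrite exchange_big /=; apply: eq_bigr => e _.
rewrite mulr_sumr; apply: eq_bigr => d _.
by rewrite (metricC e d Dx); ring.
Qed.

(** The Ricci identity; the second derivatives of X cancel by partialC. *)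
Lemma cov_commutator c a d x : D x ->
  (partial c (cov a d) x + \sum_e Gam d c e x * cov a e x)
  - (partial a (cov c d) x + \sum_e Gam d a e x * cov c e x)
  = \sum_e X x 0 e * riemann G d e c a x.
Proof.
move=> Dx.
have S p q : \sum_e Gam d p e x * cov q e x = \sum_e (Gam d p e x * partial q (xi e) x
    + X x 0 e * \sum_f Gam d p f x * Gam f q e x).
  under eq_bigr => e _ do rewrite mulrDr.
  rewrite big_split [RHS]big_split /=; congr (_ + _).
  under eq_bigr => e _ do rewrite mulr_sumr.
  rewrite exchange_big /=; apply: eq_bigr => e _.
  by rewrite mulr_sumr; apply: eq_bigr => f _; ring.
have dcov p q : partial p (cov q d) x = partial p (partial q (xi d)) x
    + \sum_e (X x 0 e * partial p (Gam d q e) x + partial p (xi e) x * Gam d q e x).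
  have hXG e k : ck k D (fun y => X y 0 e * Gam d q e y).
    by apply: ckM => //; exact: ck_christoffel.
  rewrite partialD_ck//; last 2 first.
  - by move=> k; exact: (ck_partial q (hX d _)).
  - by move=> k; exact: ck_sum.
  congr (_ + _); rewrite partial_sum_ck//; apply: eq_bigr => e _.
  by rewrite (partialM_ck p (hX e) (ck_christoffel d q e) Dx).
rewrite !dcov !S (partialC c a oD (hX d _) Dx).
rewrite opprD addrACA [in X in X + _]opprD [_ + (- partial _ _ _ - _)]addrACA subrr add0r.
rewrite -!sumrB -big_split /=; apply: eq_bigr => e _.
rewrite /riemann sumrB.
have alg (z p dxc q dxa r s v w : R) :
    z * p + dxc * q - (z * r + dxa * s) + (s * dxa + z * v - (q * dxc + z * w))
    = z * (p - r + (v - w)) by ring.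
exact: alg.
Qed.

Lemma hessX_commutator c a b x : D x -> hessX c a b x - hessX a c b x =
  \sum_d (\sum_e X x 0 e * riemann G d e c a x) * G x d b.
Proof.
move=> Dx; rewrite !hessX_cov//.
have -> : \sum_d Gam d c a x * covl d b x = \sum_d Gam d a c x * covl d b x.
  by apply: eq_bigr => d _; rewrite christoffelC.
rewrite opprB addrA subrK -sumrB; apply: eq_bigr => d _.
by rewrite -mulrBl cov_commutator.
Qed.

(** The covariant derivative of d_usq; the last sum is the difference between
the second derivatives of u and its covariant Hessian. *)
Lemma hess_usq c a x : D x -> partial c (partial a usq) x =
  2 * \sum_b X x 0 b * hessX c a b x + 2 * \sum_b covl a b x * cov c b x
  + \sum_d Gam d c a x * partial d usq x.
Proof.
move=> Dx.
have hTX b k : ck k D (fun y => covl a b y * X y 0 b) by apply: ckM => //; exact: ck_covl.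
have -> : partial c (partial a usq) x = 2 * \sum_b (covl a b x * partial c (xi b) x
    + partial c (covl a b) x * X x 0 b).
  have -> : partial c (partial a usq) x =
      partial c (fun y => 2 * \sum_b covl a b y * X y 0 b) x.
    by apply: eq_partial oD _ Dx => y; exact: d_usq.
  rewrite (partialM_ck c (fun k => @ck_cst R n k D 2)
    (fun k => ck_sum _ oD (fun b _ => hTX b k)) Dx).
  rewrite partial_cst mul0r addr0 partial_sum_ck//; congr (_ * _); apply: eq_bigr => b _.
  by rewrite (partialM_ck c (ck_covl a b) (hX b) Dx).
have E1 : \sum_d Gam d c a x * partial d usq x =
    2 * \sum_b X x 0 b * \sum_d Gam d c a x * covl d b x.
  under eq_bigr => d _ do rewrite d_usq// mulrCA mulr_sumr.
  rewrite -mulr_sumr exchange_big /=; congr (_ * _); apply: eq_bigr => b _.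
  by rewrite mulr_sumr; apply: eq_bigr => d _; ring.
have E2 : \sum_b covl a b x * cov c b x = \sum_b (covl a b x * partial c (xi b) x
    + X x 0 b * \sum_d Gam d c b x * covl a d x).
  under eq_bigr => b _ do rewrite mulrDr.
  rewrite big_split [RHS]big_split /=; congr (_ + _).
  under eq_bigr => b _ do rewrite mulr_sumr.
  rewrite exchange_big /=; apply: eq_bigr => b _.
  by rewrite mulr_sumr; apply: eq_bigr => d _; ring.
rewrite E1 E2 -!mulrDr -!big_split /=; congr (_ * _); apply: eq_bigr => b _.
rewrite /hessX; ring.
Qed.

Lemma inverse_metric_mull x a b : D x -> \sum_c invmx (G x) a c * G x c b = (a == b)%:R.
Proof.
move=> Dx; have [GU _] := posdef_inv_frame (Gp Dx).
by have /matrixP/(_ a b) := mulVmx GU; rewrite !mxE.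
Qed.

Lemma sum_inverse_metric (K : 'I_n -> 'I_n -> R) x : D x ->
  \sum_c \sum_a invmx (G x) c a * (\sum_d K c d * G x d a) = \sum_c K c c.
Proof.
move=> Dx; apply: eq_bigr => c _; rewrite -[RHS](sum_delta c).
under eq_bigr => a _ do rewrite mulr_sumr.
rewrite exchange_big /=; apply: eq_bigr => d _.
rewrite -(inverse_metric_mull c d Dx) mulr_suml; apply: eq_bigr => a _.
by rewrite (metricC d a Dx); ring.
Qed.

(** Flip the last two indices by hessX_conformal (E1), then commute the first
two derivatives (E2), which produces the Ricci tensor.  In the term that is
left, the trace falls on the two indices symmetrized by the conformal
equation, which gives n/2 d_b mu (E3). *)
Lemma trace_hessX b x : D x ->
  2 * \sum_c \sum_a invmx (G x) c a * hessX c a b x =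
  - (n%:R - 2) * partial b mu x - 2 * \sum_e X x 0 e * ricci G x b e.
Proof.
move=> Dx.
pose H c a := invmx (G x) c a.
have E1 : \sum_c \sum_a H c a * hessX c a b x + \sum_c \sum_a H c a * hessX c b a x
    = partial b mu x.
  rewrite -big_split -[RHS](sum_delta b (fun c => partial c mu x)) /=.
  apply: eq_bigr => c _.
  rewrite -big_split /= eq_sym -(inverse_metric_mull c b Dx) mulr_suml.
  by apply: eq_bigr => a _; rewrite -mulrDr hessX_conformal// /H; ring.
have E2 : \sum_c \sum_a H c a * hessX c b a x
    = \sum_c \sum_a H c a * hessX b c a x + \sum_e X x 0 e * ricci G x b e.
  apply/eqP; rewrite addrC -subr_eq -sumrB; apply/eqP.
  transitivity (\sum_c \sum_e X x 0 e * riemann G c e c b x).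
    rewrite -(sum_inverse_metric (fun c d => \sum_e X x 0 e * riemann G d e c b x) Dx).
    apply: eq_bigr => c _; rewrite -sumrB; apply: eq_bigr => a _.
    by rewrite -mulrBr hessX_commutator.
  rewrite exchange_big /=; apply: eq_bigr => e _.
  by rewrite mxE mulr_sumr.
have E3 : 2 * \sum_c \sum_a H c a * hessX b c a x = n%:R * partial b mu x.
  rewrite mulr2n mulrDl mul1r {2}exchange_big /= -big_split /=.
  transitivity (\sum_(c < n) partial b mu x); last first.
    by rewrite sumr_const card_ord mulr_natl.
  apply: eq_bigr => c _; rewrite -big_split /=.
  transitivity (\sum_a partial b mu x * (H c a * G x a c)).
    apply: eq_bigr => a _; rewrite {2}/H (inverse_metricC a c Dx) -/(H c a) -mulrDr.
    by rewrite hessX_conformal// (metricC c a Dx); ring.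
  by rewrite -mulr_sumr inverse_metric_mull// eqxx mulr1.
move/(canRL (addrK _)): E1 => ->; rewrite E2 mulrBr mulrDr E3; ring.
Qed.

(** Differentiate X(u) = mu u along X. *)
Lemma second_derivative_along_X x : D x ->
  \sum_a \sum_b X x 0 a * X x 0 b * partial a (partial b usq) x
  + \sum_c (\sum_a X x 0 a * partial a (xi c) x) * partial c usq x
  = (\sum_a X x 0 a * partial a mu x) * usq x
    + mu x * \sum_c X x 0 c * partial c usq x.
Proof.
move=> Dx.
have hXu c k : ck k D (fun y => X y 0 c * partial c usq y).
  by apply: ckM => //; exact: (ck_partial c (ck_usq _)).
have E a : \sum_b (X x 0 b * partial a (partial b usq) x
      + partial a (xi b) x * partial b usq x)
    = mu x * partial a usq x + partial a mu x * usq x.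
  rewrite -(partialM_ck a hmu ck_usq Dx).
  have <- : partial a (fun y => \sum_c X y 0 c * partial c usq y) x =
      partial a (fun y => mu y * usq y) x.
    by apply: eq_partial oD _ Dx => y; exact: X_usq.
  rewrite partial_sum_ck//; apply: eq_bigr => b _.
  by rewrite (partialM_ck a (hX b) (fun k => ck_partial b (ck_usq k.+1)) Dx).
transitivity (\sum_a X x 0 a * (mu x * partial a usq x + partial a mu x * usq x)).
  under [RHS]eq_bigr => a _ do rewrite -E mulr_sumr.
  under [X in _ + X]eq_bigr => c _ do rewrite mulr_suml.
  rewrite [X in _ + X]exchange_big -big_split /=; apply: eq_bigr => a _.
  rewrite -big_split /=; apply: eq_bigr => b _.
  have alg (p q r s t : R) : p * q * r + p * s * t = p * (q * r + s * t) by ring.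
  exact: alg.
rewrite mulr_suml mulr_sumr -big_split /=; apply: eq_bigr => a _; ring.
Qed.

(** |nabla X|^2. *)
Definition norm2_cov x : R :=
  \sum_c \sum_a invmx (G x) c a * \sum_b covl a b x * cov c b x.

Lemma norm2_cov_ge0 x : D x -> 0 <= norm2_cov x.
Proof.
move=> Dx; pose B : 'M[R]_n := \matrix_(c, a) \sum_b covl a b x * cov c b x.
have -> : norm2_cov x = \sum_c \sum_a invmx (G x) c a * B c a.
  by apply: eq_bigr => c _; apply: eq_bigr => a _; rewrite mxE.
apply: posdef_contraction_ge0 (posdef_inv (Gp Dx)) _ => v.
pose C : 'M[R]_n := \matrix_(a, d) cov a d x.
have -> : B = C *m G x *m C^T.
  apply/matrixP => c a; rewrite [LHS]mxE -mulmxA [RHS]mxE.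
  apply: eq_bigr => b _; rewrite [C c b]mxE mulrC; congr (_ * _).
  rewrite mxE; apply: eq_bigr => d _.
  by rewrite [C^T d a]mxE [C a d]mxE (metricC b d Dx) mulrC.
have -> : qform (C *m G x *m C^T) v = qform (G x) (v *m C).
  by rewrite /qform trmx_mul !mulmxA.
exact: posdef_ge0 (Gp Dx).
Qed.

(** Coefficients of the second order operator that u satisfies; the term
X^a X^b accounts for X(mu) in the Bochner formula. *)
Definition symbol x : 'M[R]_n :=
  usq x *: invmx (G x) + (n%:R - 2) *: ((X x)^T *m X x).

(** Coefficients of its first order part. *)
Definition drift x : 'rV[R]_n :=
  \row_c (- (usq x * \sum_a \sum_b invmx (G x) a b * Gam c a b x)
    + (n%:R - 2) * (\sum_a X x 0 a * partial a (xi c) x - mu x * X x 0 c)).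

Lemma symbolE x a b : symbol x a b =
  usq x * invmx (G x) a b + (n%:R - 2) * (X x 0 a * X x 0 b).
Proof. by rewrite !mxE big_ord1 !mxE. Qed.

(** The Bochner formula multiplied by u, with u X(mu) eliminated by
second_derivative_along_X. *)
Lemma bochner x : D x ->
  \sum_a \sum_b symbol x a b * partial a (partial b usq) x
  + \sum_c drift x 0 c * partial c usq x
  = 2 * usq x * (norm2_cov x - qform (ricci G x) (X x)).
Proof.
move=> Dx.
have E1 : \sum_c \sum_a invmx (G x) c a * partial c (partial a usq) x =
   - (n%:R - 2) * (\sum_b X x 0 b * partial b mu x)
   - 2 * qform (ricci G x) (X x) + 2 * norm2_cov x
   + \sum_d (\sum_c \sum_a invmx (G x) c a * Gam d c a x) * partial d usq x.
  have -> : - (n%:R - 2) * (\sum_b X x 0 b * partial b mu x)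
      - 2 * qform (ricci G x) (X x) =
      \sum_b X x 0 b * (2 * \sum_c \sum_a invmx (G x) c a * hessX c a b x).
    under [RHS]eq_bigr => b _ do rewrite (trace_hessX b Dx).
    rewrite qformE !mulr_sumr -sumrB; apply: eq_bigr => b _.
    rewrite mulrBr; congr (_ - _); first by ring.
    by rewrite !mulr_sumr; apply: eq_bigr => e _; ring.
  have -> : \sum_c \sum_a invmx (G x) c a * partial c (partial a usq) x =
    \sum_c \sum_a invmx (G x) c a * (2 * \sum_b X x 0 b * hessX c a b x)
    + \sum_c \sum_a invmx (G x) c a * (2 * \sum_b covl a b x * cov c b x)
    + \sum_c \sum_a invmx (G x) c a * (\sum_d Gam d c a x * partial d usq x).
    rewrite -!big_split /=; apply: eq_bigr => c _; rewrite -!big_split /=.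
    by apply: eq_bigr => a _; rewrite hess_usq// !mulrDr.
  congr (_ + _ + _).
  - under [RHS]eq_bigr => b _ do rewrite !mulr_sumr.
    rewrite [RHS]exchange_big /=; apply: eq_bigr => c _.
    under [RHS]eq_bigr => b _ do rewrite !mulr_sumr.
    rewrite [RHS]exchange_big /=; apply: eq_bigr => a _.
    by rewrite !mulr_sumr; apply: eq_bigr => b _; ring.
  - rewrite mulr_sumr; apply: eq_bigr => c _; rewrite mulr_sumr.
    by apply: eq_bigr => a _; ring.
  - under [RHS]eq_bigr => d _ do rewrite mulr_suml.
    rewrite [RHS]exchange_big /=; apply: eq_bigr => c _.
    under [RHS]eq_bigr => d _ do rewrite mulr_suml.
    rewrite [RHS]exchange_big /=; apply: eq_bigr => a _.
    by rewrite !mulr_sumr; apply: eq_bigr => d _; rewrite mulrA.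
have E2 := second_derivative_along_X Dx.
have -> : \sum_a \sum_b symbol x a b * partial a (partial b usq) x =
   usq x * (\sum_c \sum_a invmx (G x) c a * partial c (partial a usq) x)
   + (n%:R - 2) * (\sum_a \sum_b X x 0 a * X x 0 b * partial a (partial b usq) x).
  rewrite !mulr_sumr -big_split /=; apply: eq_bigr => a _.
  rewrite !mulr_sumr -big_split /=; apply: eq_bigr => b _.
  rewrite symbolE mulrDl; congr (_ + _); first by rewrite mulrA.
  exact/esym/mulrA.
have -> : \sum_c drift x 0 c * partial c usq x =
   - (usq x * \sum_d (\sum_c \sum_a invmx (G x) c a * Gam d c a x) * partial d usq x)
   + (n%:R - 2) * ((\sum_c (\sum_a X x 0 a * partial a (xi c) x) * partial c usq x)
       - mu x * \sum_c X x 0 c * partial c usq x).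
  rewrite mulrBr !mulr_sumr -sumrN -sumrB -big_split /=; apply: eq_bigr => c _.
  rewrite mxE.
  have alg (u s m p q y w : R) : (- (u * s) + m * (p - q * y)) * w
     = - (u * (s * w)) + (m * (p * w) - m * (q * (y * w))) by ring.
  exact: alg.
move/(canRL (addrK _)): E2 => ->; rewrite E1.
have alg (u m dm r nn gm w P : R) :
   u * (- m * dm - 2 * r + 2 * nn + gm) + m * (dm * u + w - P)
   + (- (u * gm) + m * (P - w)) = 2 * u * (nn - r) by ring.
exact: alg.
Qed.

Lemma symbol_posdef x : (1 < n)%N -> D x -> 0 < usq x -> posdef (symbol x).
Proof.
move=> n2 Dx u0; have [Hs Hp] := posdef_inv (Gp Dx).
split.
  apply/matrixP => a b; rewrite [LHS]mxE !symbolE (inverse_metricC b a Dx).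
  by congr (_ + _ * _); rewrite mulrC.
move=> v v0.
have -> : qform (symbol x) v = usq x * qform (invmx (G x)) v
   + (n%:R - 2) * (\sum_a v 0 a * X x 0 a) ^+ 2.
  rewrite !qformE mulr_sumr expr2 mulr_suml mulr_sumr -big_split /=.
  apply: eq_bigr => a _; rewrite !mulr_sumr -big_split /=; apply: eq_bigr => b _.
  by rewrite symbolE; ring.
apply: ltr_pwDl; first by rewrite mulr_gt0// Hp.
by rewrite mulr_ge0 ?sqr_ge0// subr_ge0 ler_nat.
Qed.

Lemma ck_symbol a b k : ck k D (fun x => symbol x a b).
Proof.
have : ck k D (fun x => usq x * invmx (G x) a b + (n%:R - 2) * (X x 0 a * X x 0 b)).
  apply: ckD => //; apply: ckM => //.
  - exact: ck_usq.
  - exact: ck_inverse_metric.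
  - exact: ck_cst.
  exact: ckM.
by apply: ck_eq => // x _; rewrite symbolE.
Qed.

Lemma ck_drift c k : ck k D (fun x => drift x 0 c).
Proof.
have : ck k D (fun x => - (usq x * \sum_a \sum_b invmx (G x) a b * Gam c a b x)
    + (n%:R - 2) * (\sum_a X x 0 a * partial a (xi c) x - mu x * X x 0 c)).
  apply: ckD => //.
    apply: ckN => //; apply: ckM => //; first exact: ck_usq.
    apply: ck_sum => // a _; apply: ck_sum => // b _.
    by apply: ckM => //; [exact: ck_inverse_metric|exact: ck_christoffel].
  apply: ckM => //; first exact: ck_cst.
  apply: ckB => //; last exact: ckM.
  apply: ck_sum => // a _; apply: ckM => //; exact: (ck_partial a (hX c _)).
by apply: ck_eq => // x _; rewrite mxE.
Qed.

End ChartGeometry.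

(** * Hopf's strong maximum principle *)

Section ClosedSets.
Variable R : realType.

Lemma closed_preimage_on (T : topologicalType) (C : set T) (f : T -> R)
    (F : set R) : closed C -> (forall x, C x -> {for x, continuous f}) ->
  closed F -> closed (C `&` f @^-1` F).
Proof.
move=> cC fc cF p clp.
have Cp : C p by apply: cC => B /clp[q [[Cq _] Bq]]; exists q.
split => //; apply: cF => B /(fc p Cp) nB.
by have [q [[_ Fq] Bq]] := clp _ nB; exists (f q).
Qed.

Lemma dist_continuous (V : normedModType R) (c x : V) :
  {for x, continuous (fun y => `|y - c|)}.
Proof.
apply: continuous_comp; last exact: norm_continuous.
by apply: cvgB; [exact: cvg_id|exact: cvg_cst].
Qed.

Lemma open_norm_ball (V : normedModType R) (c : V) (e : R) :
  open [set x : V | `|x - c| < e].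
Proof.
have -> : [set x : V | `|x - c| < e] = (fun x => `|x - c|) @^-1` [set t | t < e].
  by [].
by apply: open_comp => [x _|]; [exact: dist_continuous|exact: open_lt].
Qed.

Lemma nbhs_dist_lt (V : normedModType R) (c : V) (e : R) : 0 < e ->
  nbhs c [set x : V | `|x - c| < e].
Proof.
move=> e0; apply: open_nbhs_nbhs; split; first exact: open_norm_ball.
by rewrite /= subrr normr0.
Qed.

Lemma closed_box (V : normedModType R) (c : V) (r : R) :
  closed [set x : V | `|x - c| <= r].
Proof.
have := @closed_preimage_on V setT (fun x => `|x - c|) [set t | t <= r] closedT.
rewrite setTI; apply; last exact: closed_le.
by move=> x _; exact: dist_continuous.
Qed.

Lemma compact_box_level n (c : 'rV[R]_n) (r : R) (f : 'rV[R]_n -> R) (F : set R) :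
  (forall x, `|x - c| <= r -> {for x, continuous f}) -> closed F ->
  compact [set x | `|x - c| <= r /\ F (f x)].
Proof.
move=> fc cF; apply: bounded_closed_compact.
  exists (`|c| + r); split; first exact: num_real.
  move=> M hM x [xr _].
  apply: le_trans (ltW hM); rewrite -[x](subrK c) addrC.
  by apply: le_trans (ler_normD _ _) _; rewrite lerD2l.
exact: (closed_preimage_on (@closed_box 'rV[R]_n c r) fc cF).
Qed.

End ClosedSets.

Section Hopf.
Variables (R : realType) (n : nat).
Local Notation V := 'rV[R]_n.
Implicit Types (u h : V -> R) (x y z v : V) (a b c : 'I_n) (D : set V).

Implicit Types (A : V -> 'M[R]_n) (B : V -> 'rV[R]_n).

Definition elliptic (A : V -> 'M[R]_n) (B : V -> 'rV[R]_n) u x : R :=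
  \sum_a \sum_b A x a b * partial a (partial b u) x
  + \sum_c B x 0 c * partial c u x.

(** The norm on row vectors is the maximum norm; the touching balls of the Hopf
lemma have to be round, hence the Euclidean squared norm. *)
Definition sqn v : R := \sum_a v 0 a ^+ 2.

Lemma sqn_gt0 v : v != 0 -> 0 < sqn v.
Proof.
move=> v0; have s0 : 0 <= sqn v by apply: sumr_ge0 => a _; exact: sqr_ge0.
rewrite lt_neqAle s0 andbT eq_sym; apply: contra_neq v0.
move=> /psumr_eq0P H; apply/rowP => a; rewrite mxE; apply/eqP.
by rewrite -sqrf_eq0 H// => i _; exact: sqr_ge0.
Qed.

Lemma sqn_le v (e : R) : `|v| <= e -> sqn v <= n%:R * e ^+ 2.
Proof.
move=> ve; rewrite mulr_natl -[n in leRHS]card_ord -sumr_const.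
apply: ler_sum => a _; rewrite -real_normK ?num_real//.
by rewrite lerXn2r ?nnegrE// ?(le_trans _ ve)// (le_trans (coord_le_norm v a)).
Qed.

Lemma norm_le_sqn v (e : R) : 0 < e -> sqn v < e ^+ 2 -> `|v| < e.
Proof.
move=> e0 H; apply: norm_lt_coord => // a.
rewrite -(@ltr_pXn2r _ 2) ?nnegrE ?(ltW e0)// real_normK ?num_real//.
apply: le_lt_trans H; rewrite /sqn (bigD1 a)//= lerDl.
by apply: sumr_ge0 => b _; exact: sqr_ge0.
Qed.

Lemma elliptic_continuous D A B u x : open D ->
  (forall a b, ck 0 D (fun x => A x a b)) -> (forall c, ck 0 D (fun x => B x 0 c)) ->
  ck 2 D u -> D x -> {for x, continuous (elliptic A B u)}.
Proof.
move=> oD hA hB hu; apply: (@ck_continuous R n 0).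
apply: ckD => //.
  apply: ck_sum => // a _; apply: ck_sum => // b _; apply: ckM => //.
  exact: (ck_partial a (ck_partial b hu)).
apply: ck_sum => // c _; apply: ckM => //.
exact: (ckW (ck_partial c hu)).
Qed.

Lemma ellipticD D A B u h (e : R) x : open D -> ck 2 D u -> ck 2 D h -> D x ->
  elliptic A B (fun y => u y + e * h y) x = elliptic A B u x + e * elliptic A B h x.
Proof.
move=> oD hu hh Dx.
have P k f g y a : ck k.+1 D f -> ck k.+1 D g -> D y ->
    partial a (fun y => f y + e * g y) y = partial a f y + e * partial a g y.
  move=> hf hg Dy; have he := @ck_cst R n k.+1 D e.
  rewrite (partialD (ck_pder a hf Dy) (ck_pder a (ckM oD he hg) Dy)).
  by rewrite (partialM (ck_pder a he Dy) (ck_pder a hg Dy)) partial_cst mul0r addr0.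
rewrite /elliptic mulrDr addrACA; congr (_ + _).
  rewrite mulr_sumr -big_split /=; apply: eq_bigr => a _.
  rewrite mulr_sumr -big_split /=; apply: eq_bigr => b _.
  have -> : partial a (partial b (fun y => u y + e * h y)) x =
      partial a (fun y => partial b u y + e * partial b h y) x.
    apply: eq_partial oD _ Dx => y Dy; exact: (P _ _ _ _ _ hu hh Dy).
  by rewrite (P _ _ _ _ _ (ck_partial b hu) (ck_partial b hh) Dx) mulrDr mulrCA.
rewrite mulr_sumr -big_split /=; apply: eq_bigr => c _.
by rewrite (P _ _ _ _ _ hu hh Dx) mulrDr mulrCA.
Qed.

(** At a maximum the gradient vanishes and the Hessian is nonpositive. *)
Lemma elliptic_at_max D A B u x : open D -> ck 2 D u -> D x -> posdef (A x) ->
  (forall y, D y -> u y <= u x) -> elliptic A B u x <= 0.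
Proof.
move=> oD hu Dx Ap umax; rewrite /elliptic.
have [d0 _] := second_derivative_test 0 oD hu Dx umax.
rewrite [X in _ + X]big1 ?addr0; last by move=> c _; rewrite d0 mulr0.
pose Q : 'M[R]_n := \matrix_(a, b) partial a (partial b u) x.
rewrite (eq_bigr (fun a => \sum_b A x a b * Q a b)); last first.
  by move=> a _; apply: eq_bigr => b _; rewrite mxE.
apply: posdef_contraction_le0 => // v.
have [_] := second_derivative_test v oD hu Dx umax.
rewrite qformE; congr (_ <= _).
by apply: eq_bigr => a _; apply: eq_bigr => b _; rewrite mxE.
Qed.

Definition sqdist y x : R := \sum_a (x 0 a - y 0 a) ^+ 2.

Lemma sqdistE y x : sqdist y x = sqn (x - y).
Proof. by apply: eq_bigr => a _; rewrite !mxE. Qed.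

Lemma ck_sub_coord k a (t : R) : ck k [set: V] (fun x => x 0 a - t).
Proof. by apply: ckB; [exact: openT|exact: ck_coord openT|exact: ck_cst]. Qed.

Lemma ck_sqdist k y : ck k [set: V] (sqdist y).
Proof.
apply: ck_sum => [|a _]; first exact: openT.
have := ckM openT (ck_sub_coord k a (y 0 a)) (ck_sub_coord k a (y 0 a)).
by apply: ck_eq => [|x _]; [exact: openT|rewrite expr2].
Qed.

Lemma partial_sub_coord a b (t : R) x :
  partial a (fun x => x 0 b - t) x = (a == b)%:R.
Proof.
have dc : pder (cst t) x a by exact: derivable_cst.
rewrite (partialB (@pder_coord R n x a b) dc) partial_cst subr0.
exact: partial_coord.
Qed.

Lemma partial_sqdist a y x : partial a (sqdist y) x = 2 * (x 0 a - y 0 a).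
Proof.
have dc b : pder (fun x => x 0 b - y 0 b) x a.
  exact: (ck_pder a (ck_sub_coord 1 b (y 0 b)) I).
have dcc b : pder (fun x : V => (x 0 b - y 0 b) ^+ 2) x a.
  exact: (derivableM (dc b) (dc b)).
have [_ E] := @partial_sum R n _ (index_enum 'I_n) xpredT
  (fun b x => (x 0 b - y 0 b) ^+ 2) x a (fun b _ => dcc b).
apply: etrans E _; rewrite (bigD1 a)//= big1 ?addr0.
  by rewrite (partialM (dc a) (dc a)) partial_sub_coord eqxx /=; ring.
move=> b ba; rewrite (partialM (dc b) (dc b)) partial_sub_coord.
by rewrite eq_sym (negPf ba) mulr0 mul0r addr0.
Qed.

(** With s = rho - |x - y|^2, this is s + alpha s^2 - |x - z|^2.  Near z the
sum s (1 + alpha s) has the sign of s, so the barrier can be nonnegative away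
from z only inside the ball s > 0.  For a suitable
alpha the operator is positive on it at z. *)
Definition barrier (rho alpha : R) y z x : R :=
  (rho - sqdist y x) + alpha * (rho - sqdist y x) ^+ 2 - sqdist z x.

Lemma ck_barrier k rho alpha y z : ck k [set: V] (barrier rho alpha y z).
Proof.
have oT := @openT V; have hs : ck k [set: V] (fun x => rho - sqdist y x).
  by apply: ckB => //; [exact: ck_cst|exact: ck_sqdist].
apply: ckB => //; last exact: ck_sqdist.
apply: ckD => //; apply: ckM => //; first exact: ck_cst.
by apply: ck_eq (ckM oT hs hs) => // x _; rewrite expr2.
Qed.

Lemma partial_barrier rho alpha y z a x : partial a (barrier rho alpha y z) x =
  - 2 * (1 + 2 * alpha * (rho - sqdist y x)) * (x 0 a - y 0 a)
  - 2 * (x 0 a - z 0 a).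
Proof.
have oT := @openT V; have hc (t : R) := @ck_cst R n 1 setT t.
have hq w := ck_sqdist 1 w.
pose s x := rho - sqdist y x.
have hs : ck 1 [set: V] s by apply: ckB.
have ds w : partial a s w = - (2 * (w 0 a - y 0 a)).
  rewrite (partialB (ck_pder a (hc rho) I) (ck_pder a (hq y) I)).
  by rewrite partial_cst sub0r partial_sqdist.
have hs2 := ckM oT hs hs; have has2 := ckM oT (hc alpha) hs2.
have -> : barrier rho alpha y z = (fun x => s x + alpha * (s x * s x) - sqdist z x).
  by apply/funext => w; rewrite /barrier -expr2.
rewrite (partialB (ck_pder a (ckD oT hs has2) I) (ck_pder a (hq z) I)).
rewrite (partialD (ck_pder a hs I) (ck_pder a has2 I)).
rewrite (partialM (ck_pder a (hc alpha) I) (ck_pder a hs2 I)).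
rewrite (partialM (ck_pder a hs I) (ck_pder a hs I)) partial_cst partial_sqdist ds.
rewrite -/(s x); ring.
Qed.

(** At z the gradient of s is - 2 (z - y), so that alpha multiplies a positive
number as soon as y <> z; any prescribed value can be reached. *)
Lemma elliptic_barrier A B rho alpha y z : rho = sqdist y z ->
  elliptic A B (barrier rho alpha y z) z =
  8 * alpha * qform (A z) (z - y) - 4 * \tr (A z)
  - 2 * \sum_c B z 0 c * (z 0 c - y 0 c).
Proof.
move=> rhoE; have oT := @openT V; have hc (t : R) := @ck_cst R n 1 setT t.
have dd a b : partial a (partial b (barrier rho alpha y z)) z =
    8 * alpha * ((z 0 a - y 0 a) * (z 0 b - y 0 b)) - 4 * (a == b)%:R.
  have -> : partial b (barrier rho alpha y z) = (fun x =>
      - 2 * (1 + 2 * alpha * (rho - sqdist y x)) * (x 0 b - y 0 b)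
      - 2 * (x 0 b - z 0 b)) by apply/funext => x; exact: partial_barrier.
  pose s x := rho - sqdist y x.
  have hs : ck 1 [set: V] s by apply: ckB => //; exact: ck_sqdist.
  have ds : partial a s z = - (2 * (z 0 a - y 0 a)).
    rewrite (partialB (ck_pder a (hc rho) I) (ck_pder a (ck_sqdist 1 y) I)).
    by rewrite partial_cst sub0r partial_sqdist.
  have hx (t : R) := ck_sub_coord 1 b t.
  have h1 := ckM oT (hc (2 * alpha)) hs; have h2 := ckD oT (hc 1) h1.
  have h3 := ckM oT (hc (-2)) h2; have h4 := ckM oT h3 (hx (y 0 b)).
  have h5 := ckM oT (hc 2) (hx (z 0 b)).
  rewrite (partialB (ck_pder a h4 I) (ck_pder a h5 I)).
  rewrite (partialM (ck_pder a h3 I) (ck_pder a (hx _) I)).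
  rewrite (partialM (ck_pder a (hc _) I) (ck_pder a h2 I)).
  rewrite (partialD (ck_pder a (hc _) I) (ck_pder a h1 I)).
  rewrite (partialM (ck_pder a (hc _) I) (ck_pder a hs I)).
  rewrite (partialM (ck_pder a (hc _) I) (ck_pder a (hx _) I)).
  rewrite !partial_cst !partial_sub_coord ds /s rhoE subrr; ring.
have d1 c : partial c (barrier rho alpha y z) z = - 2 * (z 0 c - y 0 c).
  by rewrite partial_barrier rhoE !subrr; ring.
rewrite /elliptic; under eq_bigr => a _ do under eq_bigr => b _ do rewrite dd.
under [X in _ + X]eq_bigr => c _ do rewrite d1.
congr (_ + _); last first.
  by rewrite mulr_sumr -sumrN; apply: eq_bigr => c _; ring.
rewrite qformE /mxtrace !mulr_sumr -sumrB; apply: eq_bigr => a _.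
have -> : A z a a = \sum_b A z a b * (a == b)%:R.
  rewrite (bigD1 a)//= eqxx mulr1 big1 ?addr0// => b ba.
  by rewrite eq_sym (negPf ba) mulr0.
rewrite !mulr_sumr -sumrB; apply: eq_bigr => b _; rewrite !mxE; ring.
Qed.

Lemma sqn_distC x y : sqn (x - y) = sqn (y - x).
Proof. by apply: eq_bigr => a _; rewrite -opprB mxE sqrrN. Qed.

Lemma eq_ler (s t : R) : s = t -> s <= t.
Proof. by move=> ->. Qed.

(** If u < m at some y close to x0, inflate a Euclidean ball around y until it
touches the set u = m, at z: then u < m inside this ball.  Taking y close to
x0 keeps z away from the boundary of D. *)
Lemma touching_point D u x0 (m : R) : open D -> ck 0 D u -> D x0 -> u x0 = m ->
  (forall x, D x -> u x <= m) ->
  exists2 d : R, 0 < d & forall y, `|y - x0| < d -> u y <> m ->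
    exists z, [/\ D z, u z = m, z != y &
      exists2 r, 0 < r & forall x, `|x - z| < r ->
        D x /\ (sqdist y x < sqdist y z -> u x < m)].
Proof.
move=> oD hu Dx0 ux0 um; have [r r0 Dr] := open_ball_norm oD Dx0.
(* The factor N makes up for the ratio, at most sqrt n, of the Euclidean norm
   to the maximum norm. *)
pose N : R := n%:R + 1; have N0 : 0 < N by rewrite ltr_wpDl.
have N1 : 1 <= N by rewrite lerDr.
pose d := r / 4 / N; have d0 : 0 < d by rewrite !divr_gt0.
have dN : d * N = r / 4 by rewrite /d divfK// gt_eqF.
have dr : d <= r / 4 by rewrite -dN ler_peMr// ltW.
exists d => // y yd uy.
have r2r : r / 2 < r by lra.
have [|||z] := @EVT_min_rV R n (sqdist y) [set x | `|x - x0| <= r / 2 /\ u x = m].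
- by exists x0; split => //; rewrite subrr normr0; lra.
- apply: (@compact_box_level R n x0 (r / 2) u [set t | t = m]); last exact: closed_eq.
  move=> x xr; apply: (ck_continuous hu); apply: Dr; exact: le_lt_trans r2r.
- by apply: continuous_in_subspaceT => x _; exact: (ck_continuous (ck_sqdist 0 y)).
rewrite inE /= => -[zr uz] zmin.
have zx0 : `|z - x0| < r / 2.
  have : `|z - y| < r / 4.
    apply: norm_le_sqn; first lra.
    rewrite -sqdistE; apply: le_lt_trans (zmin x0 _) _.
      by rewrite inE /=; split => //; rewrite subrr normr0; lra.
    rewrite sqdistE sqn_distC.
    apply: le_lt_trans (sqn_le (ltW yd)) _.
    rewrite -dN [ltRHS]exprMn [ltLHS]mulrC ltr_pM2l ?exprn_gt0//.
    have n0 : 0 <= n%:R :> R by [].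
    by have := sqr_ge0 (n%:R : R); rewrite /N sqrrD1; lra.
  move=> zy; have := ler_distD y z x0; lra.
have Dz : D z by apply: Dr; exact: lt_trans r2r.
exists z; split => //.
  by apply/eqP => zy; apply: uy; rewrite -zy.
exists (r / 2 - `|z - x0|); first by rewrite subr_gt0.
move=> x xz.
have xx0 : `|x - x0| < r / 2 by have := ler_distD z x x0; lra.
have Dx : D x by apply: Dr; exact: lt_trans r2r.
split => // sx; rewrite lt_neqAle um// andbT; apply/eqP => ux.
have : sqdist y z <= sqdist y x.
  by apply: zmin; rewrite inE /=; split => //; exact: ltW.
by rewrite leNgt sx.
Qed.

(** Hopf's argument.  At a touching point z the barrier h vanishes and the
operator is positive on it.  On a small sphere around z, u + ep h < m for
small ep: where h < 0 because u <= m, and elsewhere because u < m there.  As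
u + ep h = m at z, its maximum over the small ball is interior, which
contradicts elliptic_at_max. *)
Theorem strong_maximum_principle D A B u x0 : open D ->
  (forall a b, ck 0 D (fun x => A x a b)) -> (forall c, ck 0 D (fun x => B x 0 c)) ->
  (forall x, D x -> posdef (A x)) -> ck 2 D u ->
  (forall x, D x -> 0 <= elliptic A B u x) ->
  D x0 -> (forall x, D x -> u x <= u x0) ->
  exists2 d : R, 0 < d & forall y, `|y - x0| < d -> u y = u x0.
Proof.
move=> oD hA hB Ap hu Lu Dx0 um.
have [d d0 Hd] := touching_point oD (ckW (ckW hu)) Dx0 erefl um.
exists d => // y yd; apply: contrapT => uy.
have [z [Dz uz zy [r r0 Hr]]] := Hd y yd uy.
set m := u x0 in um uy uz Hr *.
pose rho := sqdist y z.
have rho0 : 0 < rho by rewrite /rho sqdistE sqn_gt0// subr_eq0.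
(* This value of alpha makes the operator equal to 1 on the barrier at z. *)
pose alpha := (4 * \tr (A z) + 2 * (\sum_c B z 0 c * (z 0 c - y 0 c)) + 1)
  / (8 * qform (A z) (z - y)).
pose h := barrier rho alpha y z.
have hh k D' : ck k D' h by apply: ck_sub (ck_barrier k rho alpha y z).
have q0 : 0 < qform (A z) (z - y) by have [_] := Ap z Dz; apply; rewrite subr_eq0.
have Lhz : elliptic A B h z = 1.
  rewrite (elliptic_barrier A B alpha (erefl rho)) /alpha.
  by field; rewrite gt_eqF.
have hz : h z = 0.
  rewrite /h /barrier -/rho subrr expr0n mulr0 addr0 sub0r /sqdist big1 ?oppr0//.
  by move=> a _; rewrite subrr expr0n.
have cL : {for z, continuous (elliptic A B h)}.
  by apply: elliptic_continuous oD hA hB (hh _ _) Dz.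
have cs : {for z, continuous (fun x => alpha * (rho - sqdist y x))}.
  apply: (@ck_continuous R n 0 setT) => //.
  exact: (ckM openT (ck_cst 0 _ alpha) (ckB openT (ck_cst 0 _ rho) (ck_sqdist 0 y))).
have [d1 d10 H1] := continuous_eps cL ltr01.
have [d2 d20 H2] := continuous_eps cs ltr01.
pose e := Num.min r (Num.min d1 d2) / 2.
have e0 : 0 < e by rewrite divr_gt0// !lt_min r0 d10 d20.
have inN x : `|x - z| <= e -> [/\ D x, (sqdist y x < rho -> u x < m),
    0 < elliptic A B h x & 0 < 1 + alpha * (rho - sqdist y x)].
  move=> xe; have : `|x - z| < Num.min r (Num.min d1 d2).
    apply: le_lt_trans xe _.
    by rewrite /e ltr_pdivrMr// ltr_pMr ?ltr1n// !lt_min r0 d10 d20.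
  rewrite !lt_min => /and3P[/Hr[Dx sx] /H1 L1 /H2 L2]; split => //.
    by move: L1; rewrite Lhz ltr_norml; lra.
  move: L2; rewrite -/rho subrr mulr0 subr0 ltr_norml; lra.
have hpos x : `|x - z| <= e -> x != z -> 0 <= h x -> u x < m /\ h x <= 2 * rho.
  move=> xe xz hx; have [Dx sx _ al] := inN x xe.
  have qz : 0 < sqdist z x by rewrite sqdistE sqn_gt0// subr_eq0.
  have qy : 0 <= sqdist y x by rewrite sumr_ge0// => a _; exact: sqr_ge0.
  have hE : h x = (rho - sqdist y x) * (1 + alpha * (rho - sqdist y x)) - sqdist z x.
    by rewrite /h /barrier; ring.
  have sp : 0 < rho - sqdist y x.
    by rewrite -(pmulr_lgt0 _ al); move: hx; rewrite hE; lra.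
  split; first by apply: sx; rewrite -subr_gt0.
  have al2 : 1 + alpha * (rho - sqdist y x) <= 2.
    have : `|x - z| < d2.
      apply: le_lt_trans xe _; rewrite /e ltr_pdivrMr//.
      apply: le_lt_trans (_ : Num.min r (Num.min d1 d2) <= d2) _.
        by rewrite !ge_min lexx !orbT.
      by rewrite ltr_pMr ?ltr1n.
    by move=> /H2; rewrite -/rho subrr mulr0 subr0 ltr_norml; lra.
  rewrite hE; have : (rho - sqdist y x) * (1 + alpha * (rho - sqdist y x)) <= rho * 2.
    by apply: ler_pM; lra.
  lra.
(* On the part of the sphere where h >= 0, a compact set, u stays below m by a
   fixed amount, while h <= 2 rho. *)
have [ep ep0 Hep] : exists2 ep : R, 0 < ep &
    forall x, `|x - z| = e -> u x + ep * h x < m.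
  pose E := [set x | `|x - z| <= e /\ (`|x - z| = e /\ 0 <= h x)].
  have xz x : `|x - z| = e -> x != z.
    by move=> xe; apply/eqP => xz; move: e0; rewrite -xe xz subrr normr0 ltxx.
  have [[x1 Ex1]|noE] := pselect (E !=set0); last first.
    exists 1 => // x xe; have [hx|hx] := leP 0 (h x).
      by exfalso; apply: noE; exists x; split; rewrite ?xe.
    have [Dx _ _ _] := inN x (eq_ler xe); have := um x Dx; rewrite -/m; lra.
  have cE : compact E.
    have -> : E = [set x | `|x - z| <= e /\ [set t | 0 <= t] (h x)] `&`
        (setT `&` (fun x => `|x - z|) @^-1` [set t | t = e]).
      by apply/seteqP; split => x /=; [move=> [? [? ?]]|move=> [[? ?] [_ ?]]].
    apply: compact_closedI.
      apply: compact_box_level; last exact: closed_ge.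
      by move=> x _; apply: (ck_continuous (hh 0%N setT)).
    apply: closed_preimage_on; [exact: closedT| |exact: closed_eq].
    by move=> x _; exact: dist_continuous.
  have [|||x2] := @EVT_max_rV R n u E.
  - by exists x1.
  - exact: cE.
  - apply: continuous_in_subspaceT => x; rewrite inE => -[xe _].
    by have [Dx _ _ _] := inN x xe; exact: ck_continuous hu Dx.
  rewrite inE => -[x2e [x2e' hx2]] x2max.
  have [ux2 _] := hpos x2 x2e (xz _ x2e') hx2.
  exists ((m - u x2) / (4 * rho)); first by rewrite divr_gt0 ?mulr_gt0// subr_gt0.
  have ep0 : 0 < (m - u x2) / (4 * rho) by rewrite divr_gt0 ?mulr_gt0// subr_gt0.
  move=> x xe; have xe' := eq_ler xe; have [hx|hx] := leP 0 (h x).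
    have [ux hxr] := hpos x xe' (xz _ xe) hx.
    have ux2' : u x <= u x2 by apply: x2max; rewrite inE.
    have : (m - u x2) / (4 * rho) * h x <= (m - u x2) / (4 * rho) * (2 * rho).
      by rewrite ler_pM2l.
    have -> : (m - u x2) / (4 * rho) * (2 * rho) = (m - u x2) / 2.
      by field; rewrite gt_eqF.
    lra.
  have [Dx _ _ _] := inN x xe'; have := um x Dx; rewrite -/m.
  have : (m - u x2) / (4 * rho) * h x < 0 by rewrite pmulr_rlt0.
  lra.
pose w x := u x + ep * h x.
pose C := [set x : V | `|x - z| <= e].
have cw : {within C, continuous w}.
  apply: continuous_in_subspaceT => x; rewrite inE => xe.
  have [Dx _ _ _] := inN x xe; apply: (@ck_continuous R n 0 D) => //.
  exact: (ckD oD (ckW (ckW hu)) (ckM oD (@ck_cst R n 0 D ep) (hh 0%N D))).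
have cC : compact C.
  have -> : C = [set x | `|x - z| <= e /\ setT (u x)].
    by apply/seteqP; split => x /=; [|move=> []].
  apply: compact_box_level; last exact: closedT.
  by move=> x xe; have [Dx _ _ _] := inN x xe; exact: ck_continuous hu Dx.
have [|||x1] := @EVT_max_rV R n w C.
- by exists z; rewrite /C /= subrr normr0 ltW.
- exact: cC.
- exact: cw.
rewrite inE => x1e x1max.
have wz : m <= w x1.
  have -> : m = w z by rewrite /w hz mulr0 addr0.
  by apply: x1max; rewrite inE /C /= subrr normr0 ltW.
have x1lt : `|x1 - z| < e.
  rewrite lt_neqAle (x1e : `|_| <= _) andbT; apply/eqP => /Hep.
  by rewrite -/(w x1) ltNge wz.
pose D' := [set x : V | `|x - z| < e].
have oD' : open D' by exact: open_norm_ball.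
have sD : D' `<=` D by move=> x /ltW/inN[].
have hu' := ck_sub sD hu.
have hw : ck 2 D' w := (ckD oD' hu' (ckM oD' (@ck_cst R n 2 D' ep) (hh 2%N D'))).
have [Dx1 _ Lh1 _] := inN x1 x1e.
have : elliptic A B w x1 <= 0.
  apply: (elliptic_at_max B oD' hw x1lt (Ap _ Dx1)) => x xe.
  by apply: x1max; rewrite inE; exact: ltW.
rewrite (ellipticD A B ep oD' hu' (hh _ _) x1lt) leNgt.
by rewrite ltr_wpDl ?mulr_gt0 ?Lu.
Qed.

End Hopf.

(** * The squared length of a conformal field *)

Section ChartMaximum.
Variables (R : realType) (n : nat).
Local Notation V := 'rV[R]_n.
Variables (D : set V) (G : V -> 'M[R]_n) (X : V -> 'rV[R]_n).
Hypothesis oD : open D.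
Hypothesis hG : forall a b k, ck k D (fun x => G x a b).
Hypothesis hX : forall a k, ck k D (fun x => X x 0 a).
Hypothesis Gp : forall x, D x -> posdef (G x).
Hypothesis conf : forall x, D x -> exists c, lie_derivative X G x = c *: G x.

Lemma ck_lie_derivative k a b : ck k D (fun x => lie_derivative X G x a b).
Proof.
have : ck k D (fun x => \sum_c
    (X x 0 c * partial c (fun y => G y a b) x
     + G x c b * partial a (fun y => X y 0 c) x
     + G x a c * partial b (fun y => X y 0 c) x)).
  apply: ck_sum => // c _; apply: ckD => //; last first.
    by apply: ckM => //; exact: (ck_partial b (hX c _)).
  apply: ckD => //; apply: ckM => //; first exact: (ck_partial c (hG a b _)).
  exact: (ck_partial a (hX c _)).
by apply: ck_eq => // x _; rewrite mxE.
Qed.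

(** The factor is the trace of G^-1 L_X G divided by n, which is smooth. *)
Lemma smooth_conformal_factor : (0 < n)%N -> exists mu : V -> R,
  (forall k, ck k D mu) /\ (forall x, D x -> lie_derivative X G x = mu x *: G x).
Proof.
move=> n0.
exists (fun x => n%:R^-1 * \sum_a \sum_b invmx (G x) a b * lie_derivative X G x b a).
split.
  move=> k; apply: ckM => //; first exact: ck_cst.
  apply: ck_sum => // a _; apply: ck_sum => // b _; apply: ckM => //.
    exact: (ck_inverse_metric oD hG Gp).
  exact: ck_lie_derivative.
move=> x Dx; have [c Lc] := conf Dx; rewrite Lc.
suff -> : \sum_a \sum_b invmx (G x) a b * (c *: G x) b a = n%:R * c.
  by rewrite mulKf// pnatr_eq0 -lt0n.
transitivity (\sum_(a < n) c); last by rewrite sumr_const card_ord mulr_natl.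
apply: eq_bigr => a _.
transitivity (c * \sum_b invmx (G x) a b * G x b a).
  by rewrite mulr_sumr; apply: eq_bigr => b _; rewrite mxE mulrCA.
by rewrite (inverse_metric_mull Gp)// eqxx mulr1.
Qed.

(** A zero maximum means u = 0.  At a positive maximum, u is positive nearby,
so that the symbol is elliptic there. *)
Lemma usq_locally_constant x0 (r : R) : (1 < n)%N ->
  (forall x, D x -> qform (ricci G x) (X x) <= 0) ->
  0 < r -> (forall x, `|x - x0| < r -> D x /\ usq G X x <= usq G X x0) ->
  exists2 d : R, 0 < d & forall x, `|x - x0| < d -> D x /\ usq G X x = usq G X x0.
Proof.
move=> n2 ric r0 Hr.
have [mu [hmu Lmu]] := smooth_conformal_factor (ltnW n2).
have Dx0 : D x0 by have [] := Hr x0; rewrite ?subrr ?normr0.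
have u_ge0 x : D x -> 0 <= usq G X x by move=> Dx; exact: posdef_ge0 (Gp Dx).
have := u_ge0 _ Dx0; rewrite le_eqVlt => /orP[/eqP u0|u0].
  exists r => // x xr; have [Dx ux] := Hr x xr; split => //.
  by apply/eqP; rewrite eq_le ux -u0 u_ge0.
have hu k := ck_usq oD hG hX k.
have [r1 r10 H1] := continuous_eps (ck_continuous (hu 0%N) Dx0) u0.
pose D' := [set x : V | `|x - x0| < Num.min r r1].
have oD' : open D' by exact: open_norm_ball.
have D'D : D' `<=` D by move=> x; rewrite /D' /= lt_min => /andP[/Hr[]].
have D'x0 : D' x0 by rewrite /D' /= subrr normr0 lt_min r0 r10.
have D'pos x : D' x -> 0 < usq G X x.
  by rewrite /D' /= lt_min => /andP[_ /H1]; rewrite ltr_norml => /andP[+ _]; lra.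
have [d d0 Hd] : exists2 d : R, 0 < d & forall x, `|x - x0| < d ->
    usq G X x = usq G X x0.
  apply: (@strong_maximum_principle R n D' (symbol G X) (drift G X mu)) => //.
  - by move=> a b; apply: ck_sub D'D _; exact: (ck_symbol oD hG hX Gp).
  - by move=> c; apply: ck_sub D'D _; exact: (ck_drift oD hG hX Gp hmu).
  - move=> x D'x; apply: (symbol_posdef Gp n2 (D'D _ D'x)).
    exact: D'pos.
  - by apply: ck_sub D'D _; exact: hu.
  - move=> x D'x; have Dx := D'D _ D'x.
    rewrite /elliptic (bochner oD hG hX Gp hmu Lmu Dx).
    rewrite mulr_ge0 ?mulr_ge0 ?u_ge0// subr_ge0.
    exact: le_trans (ric _ Dx) (norm2_cov_ge0 X Gp Dx).
  - by move=> x; rewrite /D' /= lt_min => /andP[/Hr[]].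
exists (Num.min d r); first by rewrite lt_min d0 r0.
by move=> x; rewrite lt_min => /andP[/Hd -> /Hr[]].
Qed.

(** If u = 0 near x0, then X = 0 near x0; otherwise 0 = X(u) = mu u gives
mu = 0. *)
Lemma killing_of_usq_constant x0 (d : R) : (0 < n)%N -> 0 < d ->
  (forall x, `|x - x0| < d -> D x /\ usq G X x = usq G X x0) ->
  lie_derivative X G x0 = 0.
Proof.
move=> n0 d0 Hd.
have [mu [hmu Lmu]] := smooth_conformal_factor n0.
have Dx0 : D x0 by have [] := Hd x0; rewrite ?subrr ?normr0.
pose B := [set x : V | `|x - x0| < d].
have oB : open B by exact: open_norm_ball.
have Bx0 : B x0 by rewrite /B /= subrr normr0.
have [u0|u0] := eqVneq (usq G X x0) 0.
  have X0 x : B x -> X x = 0.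
    move=> /Hd[Dx]; rewrite u0 => ux; apply/eqP; apply: contraT => Xx.
    by have [_ /(_ _ Xx)] := Gp Dx; rewrite -/(usq G X x) ux ltxx.
  have dX0 a c : partial a (fun y => X y 0 c) x0 = 0.
    rewrite -[RHS](@partial_cst R n 0 x0 a).
    by apply: eq_partial oB _ Bx0 => x /X0 ->; rewrite mxE.
  apply/matrixP => a b; rewrite !mxE big1// => c _.
  by rewrite X0// mxE !dX0 mul0r !mulr0 !addr0.
have du a : partial a (usq G X) x0 = 0.
  rewrite -[RHS](@partial_cst R n (usq G X x0) x0 a).
  by apply: eq_partial oB _ Bx0 => x /Hd[].
have := X_usq oD hG hX Gp Lmu Dx0.
rewrite big1; last by move=> a _; rewrite du mulr0.
move/esym/eqP; rewrite mulf_eq0 (negPf u0) orbF => /eqP mu0.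
by rewrite Lmu// mu0 scale0r.
Qed.

End ChartMaximum.

(** * From charts to the manifold *)

Section Manifold.
Variables (R : realType) (n : nat) (M : topologicalType).
Variables (S : smooth_manifold R n M) (g : riemannian_metric S) (X : vector_field S).

Lemma cimg_open_chart (i : cindex S) : open (cimg (S i)).
Proof. exact: cimg_open. Qed.

Lemma metric_entry i a b k : ck k (cimg (S i)) (fun x => g i x a b).
Proof. by apply: smooth_on_entry; [exact: cimg_open_chart|exact: metric_smooth]. Qed.

Lemma vfield_entry i a k : ck k (cimg (S i)) (fun x => X i x 0 a).
Proof. by apply: smooth_on_entry; [exact: cimg_open_chart|exact: vfield_smooth]. Qed.

Lemma metric_posdef i x : cimg (S i) x -> posdef (g i x).
Proof.
move=> Dx; split; first exact: (@Defs.metric_sym _ _ _ _ g i x Dx).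
by move=> v v0; exact: (@metric_pos _ _ _ _ g i x Dx v v0).
Qed.

Lemma cmap_inK (i : cindex S) p : cdom (S i) p -> cinv (S i) (cmap (S i) p) = p.
Proof. by move=> ip; apply: cmapK; rewrite inE. Qed.

Definition usq_at (i : cindex S) (p : M) : R := usq (g i) (X i) (cmap (S i) p).

Lemma usq_at_indep i j p : cdom (S i) p -> cdom (S j) p -> usq_at i p = usq_at j p.
Proof.
move=> ip jp; pose x := cmap (S i) p.
have ov : overlap (S i) (S j) x by exists p.
have tx : transition (S i) (S j) x = cmap (S j) p.
  by rewrite /transition /= cmap_inK.
have gE := metric_compat g ov; have XE := vfield_compat X ov.
rewrite /usq_at /usq /qform -/x -tx XE gE trmx_mul.
by rewrite !mulmxA.
Qed.

Definition chart_at p : cindex S := projT1 (cid (atlas_cover S p)).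

Lemma chart_atP p : cdom (S (chart_at p)) p.
Proof. exact: projT2 (cid (atlas_cover S p)). Qed.

(** The function |X|^2 on M, read in a chosen chart at each point; usq_at_indep
shows that the choice is immaterial. *)
Definition speed2 p : R := usq_at (chart_at p) p.

Lemma speed2E i p : cdom (S i) p -> speed2 p = usq_at i p.
Proof. by move=> ip; apply: usq_at_indep => //; exact: chart_atP. Qed.

Lemma cmap_continuous_at i p : cdom (S i) p -> {for p, continuous (cmap (S i))}.
Proof.
have := @cmap_continuous _ _ _ (S i).
rewrite continuous_open_subspace; last exact: cdom_open.
by move=> H ip; apply: H; rewrite inE.
Qed.

Lemma cinv_continuous_at i x : cimg (S i) x -> {for x, continuous (cinv (S i))}.
Proof.
have := @cinv_continuous _ _ _ (S i).
rewrite continuous_open_subspace; last exact: cimg_open.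
by move=> H ix; apply: H; rewrite inE.
Qed.

Lemma speed2_continuous p : {for p, continuous speed2}.
Proof.
have ip := chart_atP p; set i := chart_at p in ip.
have : {for p, continuous (usq_at i)}.
  apply: (@continuous_comp _ _ _ (cmap (S i)) (usq (g i) (X i))).
    exact: cmap_continuous_at.
  have ix : cimg (S i) (cmap (S i) p) by exists p.
  have hu := @ck_usq R n _ (g i) (X i) (@cimg_open_chart i) (@metric_entry i)
    (@vfield_entry i) 0%N.
  exact: (ck_continuous hu ix).
apply: (@eq_continuous_at _ _ (cdom (S i))) => //; first exact: cdom_open.
by move=> q iq; rewrite (speed2E iq).
Qed.

(** Join the two points by a segment in the chart. *)
Lemma ball_in_component i p q (r : R) : cdom (S i) p ->
  (forall x, `|x - cmap (S i) p| < r -> cimg (S i) x) ->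
  cdom (S i) q -> `|cmap (S i) q - cmap (S i) p| < r ->
  connected_component setT p q.
Proof.
move=> ip Hr iq qr; set x := cmap (S i) p in Hr qr; set y := cmap (S i) q in qr.
pose gam (t : R) : 'rV[R]_n := x + t *: (y - x).
have cgam : continuous gam.
  move=> t; apply: cvgD; first exact: cvg_cst.
  by apply: cvgZr_tmp; exact: cvg_id.
have img t : t \in `[0, 1]%R -> cimg (S i) (gam t).
  rewrite in_itv /= => /andP[t0 t1]; apply: Hr.
  rewrite /gam addrAC subrr add0r normrZ ger0_norm//; apply: le_lt_trans qr.
  by rewrite ler_piMl.
have cc : {within `[0, 1], continuous (cinv (S i) \o gam)}.
  apply: continuous_in_subspaceT => t; rewrite inE => /img it.
  by apply: continuous_comp; [exact: cgam|exact: cinv_continuous_at].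
have := connected_continuous_connected (@segment_connected R 0 1) cc.
set W := (X in connected X) => cW.
have Wp : W p.
  exists 0; first by rewrite /= in_itv /= lexx ler01.
  by rewrite /= /gam scale0r addr0 cmap_inK.
have Wq : W q.
  exists 1; first by rewrite /= in_itv /= lexx ler01.
  by rewrite /= /gam scale1r addrC subrK cmap_inK.
by exists W.
Qed.

(** The set A where the maximum of |X|^2 over the component is attained is
closed by continuity, and open because of usq_locally_constant. *)
Lemma component_constant (p0 : M) : (1 < n)%N -> compact [set: M] ->
  (forall i x, cimg (S i) x -> exists c, lie_derivative (X i) (g i) x = c *: g i x) ->
  (forall i x, cimg (S i) x -> qform (ricci (g i) x) (X i x) <= 0) ->
  forall i p, connected_component setT p0 p -> cdom (S i) p ->
  exists2 d : R, 0 < d & forall x, `|x - cmap (S i) p| < d ->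
    cimg (S i) x /\
    usq (g i) (X i) x = usq (g i) (X i) (cmap (S i) p).
Proof.
move=> n2 cM conf ric.
pose C := connected_component setT p0.
have Cp0 : C p0 by exact: connected_component_refl.
have clC : closed C by apply: component_closed; exact: closedT.
have cC : compact C by exact: subclosed_compact clC cM _.
have [||q] := @compact_EVT_max M R speed2 C _ cC.
- by exists p0.
- by apply: continuous_in_subspaceT => p _; exact: speed2_continuous.
rewrite inE => Cq qmax; set m := speed2 q in qmax.
have local i p : C p -> cdom (S i) p -> speed2 p = m ->
    exists2 d : R, 0 < d & forall x, `|x - cmap (S i) p| < d ->
      [/\ cimg (S i) x, usq (g i) (X i) x = usq (g i) (X i) (cmap (S i) p) &
       forall p', cdom (S i) p' -> cmap (S i) p' = x -> C p'].
  move=> Cp ip pm; set x0 := cmap (S i) p.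
  have ix0 : cimg (S i) x0 by exists p.
  have [r r0 Hr] := open_ball_norm (@cimg_open_chart i) ix0.
  have inC x p' : `|x - x0| < r -> cdom (S i) p' -> cmap (S i) p' = x -> C p'.
    move=> xr ip' p'x; apply: connected_component_trans Cp _.
    by apply: (ball_in_component ip Hr ip'); rewrite p'x.
  have [|||d d0 Hd] := @usq_locally_constant R n (cimg (S i)) (g i) (X i)
      (@cimg_open_chart i) (@metric_entry i) (@vfield_entry i) (@metric_posdef i)
      (conf i) x0 r n2.
  - by move=> x; exact: ric.
  - exact: r0.
  - move=> x xr; have ix := Hr x xr; split => //.
    have [p' ip' p'x] := ix; have Cp' := inC x p' xr ip' p'x.
    rewrite -p'x -/(usq_at i p') -/(usq_at i p) -(speed2E ip') -(speed2E ip) pm.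
    by apply: qmax; rewrite inE.
  exists (Num.min d r); first by rewrite lt_min d0 r0.
  move=> x; rewrite lt_min => /andP[xd xr]; have [ix ux] := Hd x xd.
  by split => // p'; exact: inC.
pose A := C `&` speed2 @^-1` [set t | t = m].
have clA : closed A.
  exact: (closed_preimage_on clC (fun p _ => @speed2_continuous p) (@closed_eq R m)).
have oA : open A.
  rewrite openE => p [Cp pm]; have ip := chart_atP p; set i := chart_at p in ip.
  have [d d0 Hd] := local i p Cp ip pm.
  have nd : nbhs p (cdom (S i)) by apply: open_nbhs_nbhs; split => //; exact: cdom_open.
  have nb : nbhs p (fun p' => `|cmap (S i) p' - cmap (S i) p| < d).
    exact: (cmap_continuous_at ip (@nbhs_dist_lt R 'rV[R]_n _ d d0)).
  near=> p'.
  have ip' : cdom (S i) p' by near: p'.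
  have p'd : `|cmap (S i) p' - cmap (S i) p| < d by near: p'.
  have [_ up' Cp'] := Hd _ p'd; split; first exact: Cp'.
  by rewrite /= (speed2E ip') /usq_at up' -/(usq_at i p) -(speed2E ip).
have AC : A = C.
  apply: (@component_connected _ setT p0).
  - by exists q; split.
  - by exists A => //; rewrite /A setIA setIid.
  - by exists A => //; rewrite /A setIA setIid.
move=> i p Cp ip.
have [_ pm] : A p by rewrite AC.
have [d d0 Hd] := local i p Cp ip pm.
by exists d => // x /Hd[].
Unshelve. all: by end_near. Qed.

End Manifold.

Theorem corollary1p5 (R : realType) (n k : nat)
    (hn : (3 <= n)%N) (hk : (2 <= k <= n)%N)
    (M : topologicalType) (S : smooth_manifold R n M)
    (hM : compact [set: M])
    (g : riemannian_metric S) (X : vector_field S) (lambda : R)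
    (hsol : k_yamabe_soliton g k X lambda)
    (hric : nonpositive_ricci g) :
  trivial_soliton g X.
Proof.
have conf i x : cimg (S i) x -> exists c, lie_derivative (X i) (g i) x = c *: g i x.
  move=> ix; exists (2 * (2 * (n%:R - 1) * (sigma k (g i) x - lambda))).
  by rewrite -scalerA -(hsol i x ix) scalerA mulfV ?pnatr_eq0// scale1r.
move=> i _ [p ip <-].
have ric j x : cimg (S j) x -> qform (ricci (g j) x) (X j x) <= 0.
  by move=> jx; exact: hric.
have Cp : connected_component setT p p by exact: connected_component_refl.
have [d d0 Hd] := component_constant (ltnW hn) hM conf ric Cp ip.
apply: (@killing_of_usq_constant R n (cimg (S i)) (g i) (X i)
      (@cimg_open_chart _ _ _ S i) (@metric_entry _ _ _ _ g i) (@vfield_entry _ _ _ _ X i)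
      (@metric_posdef _ _ _ _ g i) (conf i) _ d) => //.
exact: leq_trans hn.
Qed.
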